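(* Let $\alpha$ be an infinite cardinal. Suppose $E$ and $F$ are Dedekind $\alpha$-complete Riesz spaces. The following are equivalent. (1) $E_x \bar{\otimes} F_y$ is Dedekind $\alpha$-complete for every $x \in E^+$ and $y \in F^+$. (2) [$E_x$ is finite dimensional for every $x \in E^+$] or [$F_y$ is finite dimensional for every $y \in F^+$]. (3) $E \cong c_{00}(I)$ for a set $I \subseteq E$ or $F \cong c_{00}(J)$ for a set $J \subseteq F$. (4) $E\bar{\otimes}F \cong c_{00}(I,F)$ for a set $I \subseteq E$ or $E\bar{\otimes}F \cong c_{00}(J,E)$ for a set $J \subseteq F$. (5) $E\bar{\otimes}F$ is Dedekind $\alpha$-complete.
   Context: A Riesz space is a real vector lattice; $E^+$ denotes the positive cone of $E$, and $\cong$ denotes Riesz isomorphism. For an infinite cardinal $\alpha$, an Archimedean Riesz space $E$ is Dedekind $\alpha$-complete if every nonempty subset $A\subseteq E$ that is bounded above and has cardinality $|A|\le\alpha$ has a supremum in $E$. Principal ideal: for $f\in E$, $E_f=\{g\in E: |g|\le\lambda|f| \text{ for some } \lambda\in\mathbb{R}^+\}$, a Riesz space in its own right. Fremlin tensor product: for Archimedean Riesz spaces $E,F,G$, a Riesz bimorphism is a bilinear map $T:E\times F\to G$ such that $z\mapsto T(z,y)$, $E\to G$, and $z\mapsto T(x,z)$, $F\to G$, are Riesz homomorphisms for all $x\in E^+$, $y\in F^+$. The Archimedean Riesz space tensor product (Fremlin tensor product) $E\bar{\otimes}F$ is the Archimedean Riesz space, unique up to Riesz isomorphism, equipped with a Riesz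 bimorphism $\otimes:E\times F\to E\bar{\otimes}F$ such that for every Archimedean Riesz space $H$ and every Riesz bimorphism $\psi:E\times F\to H$ there is a unique Riesz homomorphism $T:E\bar{\otimes}F\to H$ with $T\circ\otimes=\psi$. For a nonempty set $I$ and an Archimedean Riesz space $G$, $c_{00}(I,G)$ is the Archimedean Riesz space (pointwise operations and order) of all maps $f:I\to G$ such that $\{x\in I: f(x)\ne 0\}$ is finite; $c_{00}(I)=c_{00}(I,\mathbb{R})$.
   Formalization: In (3) and (4) the sets I and J may be empty, with c00(∅,G) = 0; with nonempty I and J the equivalence fails for E = 0 and F = ℓ^∞, where (2) and (5) hold but (3) does not. *)

(* Defs.v *)
From HB Require Import structures.
From mathcomp Require Import all_boot all_order all_algebra.
From mathcomp Require Import all_classical all_reals.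

Set Implicit Arguments.
Unset Strict Implicit.
Unset Printing Implicit Defensive.

Import Order.TTheory GRing.Theory Num.Theory.
Local Open Scope classical_set_scope.
Local Open Scope quotient_scope.
Local Open Scope ring_scope.

(* The lattice operations are fields of the mixin, rather than coming from
   Order.Lattice, because Hierarchy Builder rejects a structure that inherits
   from both Num.POrderedZmodule and Order.Lattice ring_display: Num.RealDomain
   already does, and no common join of the two was declared below it. *)
HB.mixin Record POrderedLmodule_isRiesz (R : realType) E
    of GRing.Lmodule R E & Num.POrderedZmodule E := {
  vjoin : E -> E -> E;
  vmeet : E -> E -> E;
  vjoin_le : forall x y z : E, (vjoin x y <= z) = (x <= z) && (y <= z);
  le_vmeet : forall x y z : E, (z <= vmeet x y) = (z <= x) && (z <= y);
  vleD2l : forall z x y : E, x <= y -> z + x <= z + y;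
  vscale_ge0 : forall (a : R) (x : E), 0 <= a -> 0 <= x -> 0 <= a *: x
}.

#[short(type="rieszType")]
HB.structure Definition Riesz (R : realType) :=
  { E of GRing.Lmodule R E & Num.POrderedZmodule E
       & POrderedLmodule_isRiesz R E }.

HB.mixin Record Riesz_isArchimedean (R : realType) E of Riesz R E := {
  varchimedean :
    forall x y : E, (forall n : nat, x *+ n.+1 <= y) -> x <= 0
}.

#[short(type="archRieszType")]
HB.structure Definition ArchRiesz (R : realType) :=
  { E of Riesz R E & Riesz_isArchimedean R E }.

Section RieszTheory.
Variables (R : realType) (E : rieszType R).
Implicit Types (x y z : E) (a : R).

Definition vabs x : E := vjoin x (- x).

Lemma vjoinl x y : x <= vjoin x y.
Proof. by have := lexx (vjoin x y); rewrite vjoin_le => /andP[]. Qed.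

Lemma vjoinr x y : y <= vjoin x y.
Proof. by have := lexx (vjoin x y); rewrite vjoin_le => /andP[]. Qed.

Lemma vleD x y z t : x <= y -> z <= t -> x + z <= y + t.
Proof.
move=> xy zt; apply: (le_trans (vleD2l x _ _ zt)).
by rewrite addrC [y + t]addrC; exact: vleD2l.
Qed.

Lemma vsub_ge0 x y : (0 <= y - x) = (x <= y).
Proof.
apply/idP/idP => [/(vleD2l x _ _)|/(vleD2l (- x) _ _)]; first by rewrite addr0 subrKC.
by rewrite addNr [- x + y]addrC.
Qed.

Lemma vleN2 x y : (- x <= - y) = (y <= x).
Proof. by rewrite -[LHS]vsub_ge0 opprK addrC vsub_ge0. Qed.

Lemma vleNl x y : (- x <= y) = (- y <= x).
Proof. by rewrite -{1}[y]opprK vleN2. Qed.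

Lemma vleNr x y : (x <= - y) = (y <= - x).
Proof. by rewrite -{1}[x]opprK vleN2. Qed.

Lemma vleZ a x y : 0 <= a -> x <= y -> a *: x <= a *: y.
Proof.
by move=> a0 xy; rewrite -vsub_ge0 -scalerBr vscale_ge0 // vsub_ge0.
Qed.

Lemma vleMn x y n : x <= y -> x *+ n <= y *+ n.
Proof. by move=> xy; rewrite -!scaler_nat vleZ. Qed.

Lemma vmeetE x y : vmeet x y = - vjoin (- x) (- y).
Proof.
apply/eqP; rewrite eq_le; apply/andP; split.
  by rewrite vleNr vjoin_le !vleN2 -le_vmeet.
by rewrite le_vmeet !(vleNl (vjoin _ _)) vjoinl vjoinr.
Qed.

Lemma vabs_le x y : (vabs x <= y) = (x <= y) && (- x <= y).
Proof. exact: vjoin_le. Qed.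

Lemma vabs_ge x : x <= vabs x. Proof. exact: vjoinl. Qed.

Lemma vabs_geN x : - x <= vabs x. Proof. exact: vjoinr. Qed.

Lemma vabs_ge0 x : 0 <= vabs x.
Proof.
have h : 0 <= vabs x *+ 2.
  by have := vleD (vabs_ge x) (vabs_geN x); rewrite subrr mulr2n.
have i2 : (0 : R) <= 2%:R^-1 by rewrite invr_ge0 ler0n.
have := vscale_ge0 _ _ i2 h.
by rewrite -scaler_nat scalerA mulVf ?pnatr_eq0// scale1r.
Qed.

Lemma vabsD x y : vabs (x + y) <= vabs x + vabs y.
Proof.
rewrite vabs_le vleD ?vabs_ge//= opprD.
by rewrite vleD ?vabs_geN.
Qed.

Lemma vabsN x : vabs (- x) = vabs x.
Proof.
suff le_absN y : vabs (- y) <= vabs y.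
  by apply/eqP; rewrite eq_le le_absN -{1}[x]opprK le_absN.
by rewrite vabs_le opprK vabs_ge vabs_geN.
Qed.

Lemma vabsZ a x : vabs (a *: x) <= `|a| *: vabs x.
Proof.
have [a0|/ltW a0] := leP 0 a.
  by rewrite ger0_norm// vabs_le -scalerN !vleZ ?vabs_ge ?vabs_geN.
have -> : a *: x = (- a) *: (- x) by rewrite scaleNr scalerN opprK.
rewrite ler0_norm// vabs_le -scalerN opprK.
by rewrite !vleZ ?oppr_ge0 ?vabs_ge ?vabs_geN.
Qed.

Lemma vabs_join x y : vabs (vjoin x y) <= vabs x + vabs y.
Proof.
have xle : x <= vabs x + vabs y.
  by rewrite -[leLHS]addr0 vleD ?vabs_ge ?vabs_ge0.
have yle : y <= vabs x + vabs y.
  by rewrite -[leLHS]add0r vleD ?vabs_ge ?vabs_ge0.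
rewrite vabs_le vjoin_le xle yle /=.
apply: (@le_trans _ _ (- x)); first by rewrite vleN2 vjoinl.
by rewrite -[leLHS]addr0 vleD ?vabs_geN ?vabs_ge0.
Qed.

Lemma vabs_meet x y : vabs (vmeet x y) <= vabs x + vabs y.
Proof. by rewrite vmeetE vabsN (le_trans (vabs_join _ _)) ?vabsN. Qed.

End RieszTheory.

Section RegularRiesz.
Variable R : realType.

HB.instance Definition _ := Order.POrder.copy R^o R.

Fact regular_vjoin_le (x y z : R^o) :
  (Num.max (x : R) y <= z) = (x <= z) && (y <= z).
Proof. exact: (@ge_max _ R). Qed.

Fact regular_le_vmeet (x y z : R^o) :
  (z <= Num.min (x : R) y) = (z <= x) && (z <= y).
Proof. exact: (@le_min _ R). Qed.

Fact regular_vleD2l (z x y : R^o) : x <= y -> z + x <= z + y.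
Proof. by move=> xy; rewrite (@lerD2l R). Qed.

Fact regular_vscale_ge0 (a : R) (x : R^o) : 0 <= a -> 0 <= x -> 0 <= a *: x.
Proof. exact: (@mulr_ge0 R). Qed.

HB.instance Definition _ := POrderedLmodule_isRiesz.Build R R^o
  regular_vjoin_le regular_le_vmeet regular_vleD2l regular_vscale_ge0.

Fact regular_varchimedean (x y : R^o) :
  (forall n : nat, x *+ n.+1 <= y) -> x <= 0.
Proof.
move=> xy; rewrite -[_ <= _]/((x : R) <= 0) leNgt; apply/negP => x_gt0.
pose n := Num.bound `|(y : R) / x|.
have : (x : R) *+ n.+1 <= y := xy n; apply/negP.
rewrite -ltNge -mulr_natl -ltr_pdivrMr//; apply: (le_lt_trans (ler_norm _)).
by rewrite (lt_trans (archi_boundP (normr_ge0 _)))// ltr_nat.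
Qed.

HB.instance Definition _ := Riesz_isArchimedean.Build R R^o regular_varchimedean.

End RegularRiesz.

Section RieszMorphisms.
Variable R : realType.

Definition riesz_hom (E F : rieszType R) (f : E -> F) : Prop :=
  [/\ linear f, {morph f : x y / vjoin x y} & {morph f : x y / vmeet x y}].

Definition riesz_iso (E F : rieszType R) : Prop :=
  exists f : E -> F, riesz_hom f /\ bijective f.

Definition riesz_bimorphism (E F G : rieszType R) (T : E -> F -> G) : Prop :=
  [/\ forall y, linear (T^~ y), forall x, linear (T x),
      forall y, 0 <= y -> riesz_hom (T^~ y)
    & forall x, 0 <= x -> riesz_hom (T x)].

Definition is_fremlin_tensor (E F G : archRieszType R) (t : E -> F -> G) :=
  riesz_bimorphism t /\
  forall (H : archRieszType R) (psi : E -> F -> H), riesz_bimorphism psi ->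
    exists! T : G -> H, riesz_hom T /\ forall x y, T (t x y) = psi x y.

Definition finite_dimensional (V : lmodType R) : Prop :=
  exists (n : nat) (e : 'I_n -> V),
    forall v, exists c : 'I_n -> R, v = \sum_(i < n) c i *: e i.

(* The cardinal alpha is represented by a type A with |A| = alpha. *)
Definition dedekind_complete (A : Type) (E : archRieszType R) : Prop :=
  forall S : set E, S !=set0 -> has_ubound S -> (S #<= [set: A])%card ->
    supremums S !=set0.

End RieszMorphisms.

Notation "E ≅ F" := (riesz_iso E F) (at level 70, no associativity).

Section PrincipalIdeal.
Variables (R : realType) (E : archRieszType R) (f : E).

Definition in_principal : {pred E} := fun g =>
  `[< exists l : R, 0 <= l /\ vabs g <= l *: vabs f >].

Record principal :=
  Principal { principal_val : E; _ : principal_val \in in_principal }.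

HB.instance Definition _ := [isSub for principal_val].
HB.instance Definition _ := [Choice of principal by <:].

Fact in_principal_submod : submod_closed in_principal.
Proof.
split=> [|a u v /asboolP[l [l0 lu]] /asboolP[m [m0 mv]]]; apply/asboolP.
  by exists 0; split=> //; rewrite scale0r vabs_le oppr0 lexx.
exists (`|a| * l + m); split; first by rewrite addr_ge0 ?mulr_ge0.
apply: (le_trans (vabsD _ _)); rewrite scalerDl vleD//.
by apply: (le_trans (vabsZ _ _)); rewrite -scalerA vleZ.
Qed.

HB.instance Definition _ :=
  GRing.SubChoice_isSubLmodule.Build R E in_principal principal
    in_principal_submod.

Fact in_principal_abs u v w : vabs w <= vabs u + vabs v ->
  u \in in_principal -> v \in in_principal -> w \in in_principal.
Proof.
move=> wuv /asboolP[l [l0 lu]] /asboolP[m [m0 mv]]; apply/asboolP.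
exists (l + m); split; first by rewrite addr_ge0.
by rewrite (le_trans wuv)// scalerDl vleD.
Qed.

Definition principal_le (u v : principal) := val u <= val v.

Fact principal_le_refl : reflexive principal_le.
Proof. by move=> u; exact: lexx. Qed.

Fact principal_le_anti : antisymmetric principal_le.
Proof. by move=> u v uv; apply/val_inj/le_anti. Qed.

Fact principal_le_trans : transitive principal_le.
Proof. by move=> v u w; exact: le_trans. Qed.

HB.instance Definition _ := Order.Le_isPOrder.Build ring_display principal
  principal_le_refl principal_le_anti principal_le_trans.

Definition principal_join (u v : principal) : principal :=
  Principal (in_principal_abs (vabs_join (val u) (val v)) (valP u) (valP v)).

Definition principal_meet (u v : principal) : principal :=
  Principal (in_principal_abs (vabs_meet (val u) (val v)) (valP u) (valP v)).

Fact principal_join_le (x y z : principal) :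
  (principal_join x y <= z) = (x <= z) && (y <= z).
Proof. exact: (vjoin_le (val x) (val y) (val z)). Qed.

Fact principal_le_meet (x y z : principal) :
  (z <= principal_meet x y) = (z <= x) && (z <= y).
Proof. exact: (le_vmeet (val x) (val y) (val z)). Qed.

Fact principal_leD2l (z x y : principal) : x <= y -> z + x <= z + y.
Proof. exact: (vleD2l (val z) (val x) (val y)). Qed.

Fact principal_scale_ge0 (a : R) (x : principal) :
  0 <= a -> 0 <= x -> 0 <= a *: x.
Proof. exact: (vscale_ge0 a (val x)). Qed.

HB.instance Definition _ := POrderedLmodule_isRiesz.Build R principal
  principal_join_le principal_le_meet principal_leD2l principal_scale_ge0.

Fact principal_archimedean (x y : principal) :
  (forall n : nat, x *+ n.+1 <= y) -> x <= 0.
Proof.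
move=> xy; apply: (varchimedean (val x) (val y)) => n.
by have := xy n; rewrite /Order.le/= /principal_le (raddfMn val).
Qed.

HB.instance Definition _ :=
  Riesz_isArchimedean.Build R principal principal_archimedean.

End PrincipalIdeal.

Section FinitelySupported.
Variables (R : realType) (I : Type) (G : archRieszType R).

Definition in_c00 : {pred I -> G} := fun f =>
  `[< finite_set [set i | f i != 0] >].

(* I may be empty: c00 I G is then the zero space, which is needed for the zero
   space to be of this form. *)
Record c00 := C00 { c00_val :> I -> G; _ : c00_val \in in_c00 }.

HB.instance Definition _ := [isSub for c00_val].
HB.instance Definition _ := [Choice of c00 by <:].

Fact in_c00_op (op : G -> G -> G) (f g : I -> G) : op 0 0 = 0 ->
  f \in in_c00 -> g \in in_c00 -> (fun i => op (f i) (g i)) \in in_c00.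
Proof.
move=> op0 /asboolP fin_f /asboolP fin_g; apply/asboolP.
have fin_fg : finite_set ([set i | f i != 0] `|` [set i | g i != 0]).
  by rewrite finite_setU.
apply: sub_finite_set fin_fg => i /=.
have [fi0|] := eqVneq (f i) 0; last by left.
have [gi0|] := eqVneq (g i) 0; last by right.
by rewrite fi0 gi0 op0 eqxx.
Qed.

Fact in_c00_submod : submod_closed in_c00.
Proof.
split=> [|a u v cu cv].
  apply/asboolP; rewrite (_ : [set i | _] = set0); first exact: finite_set0.
  by apply/seteqP; split=> i //=; rewrite eqxx.
by apply: (in_c00_op (op := fun s t => a *: s + t)) => //; rewrite scaler0 addr0.
Qed.

HB.instance Definition _ :=
  GRing.SubChoice_isSubLmodule.Build R (I -> G) in_c00 c00 in_c00_submod.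

Definition c00_le (f g : c00) : bool := `[< forall i, f i <= g i >].

Fact c00_le_refl : reflexive c00_le.
Proof. by move=> f; apply/asboolP. Qed.

Fact c00_le_anti : antisymmetric c00_le.
Proof.
move=> f g /andP[/asboolP fg /asboolP gf]; apply/val_inj/funext => i.
by apply: le_anti; rewrite fg gf.
Qed.

Fact c00_le_trans : transitive c00_le.
Proof.
move=> g f h /asboolP fg /asboolP gh; apply/asboolP => i.
exact: le_trans (fg i) (gh i).
Qed.

HB.instance Definition _ := Order.Le_isPOrder.Build ring_display c00
  c00_le_refl c00_le_anti c00_le_trans.

Lemma c00_leP (f g : c00) : reflect (forall i, f i <= g i) (f <= g).
Proof. exact: asboolP. Qed.

Fact vjoin00 : vjoin 0 0 = 0 :> G.
Proof. by apply/eqP; rewrite eq_le vjoinl andbT vjoin_le lexx. Qed.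

Fact vmeet00 : vmeet 0 0 = 0 :> G.
Proof. by rewrite vmeetE !oppr0 vjoin00 oppr0. Qed.

Definition c00_join (f g : c00) : c00 :=
  C00 (in_c00_op vjoin00 (valP f) (valP g)).

Definition c00_meet (f g : c00) : c00 :=
  C00 (in_c00_op vmeet00 (valP f) (valP g)).

Fact c00_join_le (x y z : c00) :
  (c00_join x y <= z) = (x <= z) && (y <= z).
Proof.
apply/c00_leP/andP => [h|[/c00_leP xz /c00_leP yz] i]; last first.
  by rewrite vjoin_le xz yz.
by split; apply/c00_leP => i; have := h i; rewrite vjoin_le => /andP[].
Qed.

Fact c00_le_meet (x y z : c00) :
  (z <= c00_meet x y) = (z <= x) && (z <= y).
Proof.
apply/c00_leP/andP => [h|[/c00_leP zx /c00_leP zy] i]; last first.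
  by rewrite le_vmeet zx zy.
by split; apply/c00_leP => i; have := h i; rewrite le_vmeet => /andP[].
Qed.

Fact c00_leD2l (z x y : c00) : x <= y -> z + x <= z + y.
Proof. by move=> /c00_leP xy; apply/c00_leP => i; exact: vleD2l. Qed.

Fact c00_scale_ge0 (a : R) (x : c00) : 0 <= a -> 0 <= x -> 0 <= a *: x.
Proof.
by move=> a0 /c00_leP x0; apply/c00_leP => i; exact: vscale_ge0 (x0 i).
Qed.

HB.instance Definition _ := POrderedLmodule_isRiesz.Build R c00
  c00_join_le c00_le_meet c00_leD2l c00_scale_ge0.

Fact c00_archimedean (x y : c00) :
  (forall n : nat, x *+ n.+1 <= y) -> x <= 0.
Proof.
move=> xy; apply/c00_leP => i; apply: (varchimedean (x i) (y i)) => n.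
have /c00_leP/(_ i) := xy n; apply: le_trans.
by rewrite -!scaler_nat lexx.
Qed.

HB.instance Definition _ := Riesz_isArchimedean.Build R c00 c00_archimedean.

End FinitelySupported.

(* A concrete model of the object characterised by is_fremlin_tensor: the
   Riesz-space expressions over symbols TGen x y, with x in E and y in F,
   identified when they take the same value under every Riesz bimorphism into
   an Archimedean Riesz space. fremlin_tensorP below is the universal property
   and is_fremlin_tensor_unique its uniqueness up to Riesz isomorphism. *)
Section FremlinTensor.
Variables (R : realType) (E F : archRieszType R).

Inductive texpr : Type :=
  | TGen of E & F
  | TZero
  | TAdd of texpr & texpr
  | TScale of R & texpr
  | TJoin of texpr & texpr.

HB.instance Definition _ := gen_eqMixin texpr.
HB.instance Definition _ := gen_choiceMixin texpr.

Fixpoint teval (H : archRieszType R) (psi : E -> F -> H) (s : texpr) : H :=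
  match s with
  | TGen x y => psi x y
  | TZero => 0
  | TAdd s1 s2 => teval psi s1 + teval psi s2
  | TScale a s1 => a *: teval psi s1
  | TJoin s1 s2 => vjoin (teval psi s1) (teval psi s2)
  end.

Definition teq (s t : texpr) : bool :=
  `[< forall (H : archRieszType R) (psi : E -> F -> H),
        riesz_bimorphism psi -> teval psi s = teval psi t >].

Fact teq_refl : reflexive teq.
Proof. by move=> s; apply/asboolP. Qed.

Fact teq_sym : symmetric teq.
Proof.
by move=> s t; apply/asboolP/asboolP => st H psi bpsi; rewrite st.
Qed.

Fact teq_trans : transitive teq.
Proof.
move=> t s u /asboolP st /asboolP tu; apply/asboolP => H psi bpsi.
by rewrite st// tu.
Qed.

Canonical teq_equiv := EquivRel teq teq_refl teq_sym teq_trans.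

Definition fremlin_tensor := {eq_quot teq}.

HB.instance Definition _ := Choice.on fremlin_tensor.
HB.instance Definition _ := EqQuotient.on fremlin_tensor.

Implicit Types X Y Z : fremlin_tensor.

Definition tensor (x : E) (y : F) : fremlin_tensor := \pi_fremlin_tensor (TGen x y).
Definition tensor_zero : fremlin_tensor := \pi_fremlin_tensor TZero.
Definition tensor_add X Y : fremlin_tensor := \pi_fremlin_tensor (TAdd (repr X) (repr Y)).
Definition tensor_scale (a : R) X : fremlin_tensor := \pi_fremlin_tensor (TScale a (repr X)).
Definition tensor_opp X := tensor_scale (- 1) X.
Definition tensor_join X Y : fremlin_tensor := \pi_fremlin_tensor (TJoin (repr X) (repr Y)).
Definition tensor_meet X Y :=
  tensor_opp (tensor_join (tensor_opp X) (tensor_opp Y)).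
Definition tensor_le X Y : bool :=
  `[< forall (H : archRieszType R) (psi : E -> F -> H),
        riesz_bimorphism psi -> teval psi (repr X) <= teval psi (repr Y) >].

Definition tensor_lift (H : archRieszType R) (psi : E -> F -> H) X : H :=
  teval psi (repr X).

Section Lift.
Variables (H : archRieszType R) (psi : E -> F -> H).
Hypothesis bpsi : riesz_bimorphism psi.

Lemma tensor_lift_pi (s : texpr) : tensor_lift psi (\pi_fremlin_tensor s) = teval psi s.
Proof.
rewrite /tensor_lift; case: piP => t /eqmodP/asboolP -/(_ H psi bpsi).
by move=> ->.
Qed.

Lemma tensor_lift_gen x y : tensor_lift psi (tensor x y) = psi x y.
Proof. exact: tensor_lift_pi. Qed.

Lemma tensor_lift0 : tensor_lift psi tensor_zero = 0.
Proof. exact: tensor_lift_pi. Qed.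

Lemma tensor_liftD X Y :
  tensor_lift psi (tensor_add X Y) = tensor_lift psi X + tensor_lift psi Y.
Proof. exact: tensor_lift_pi. Qed.

Lemma tensor_liftZ a X :
  tensor_lift psi (tensor_scale a X) = a *: tensor_lift psi X.
Proof. exact: tensor_lift_pi. Qed.

Lemma tensor_liftN X : tensor_lift psi (tensor_opp X) = - tensor_lift psi X.
Proof. by rewrite tensor_liftZ scaleN1r. Qed.

Lemma tensor_lift_join X Y :
  tensor_lift psi (tensor_join X Y) =
  vjoin (tensor_lift psi X) (tensor_lift psi Y).
Proof. exact: tensor_lift_pi. Qed.

Lemma tensor_lift_meet X Y :
  tensor_lift psi (tensor_meet X Y) =
  vmeet (tensor_lift psi X) (tensor_lift psi Y).
Proof. by rewrite tensor_liftN tensor_lift_join !tensor_liftN vmeetE. Qed.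

End Lift.

Definition tensor_liftE :=
  (tensor_lift0, tensor_liftD, tensor_liftN, tensor_liftZ, tensor_lift_join,
   tensor_lift_meet).

Lemma tensor_ext X Y :
  (forall (H : archRieszType R) (psi : E -> F -> H),
     riesz_bimorphism psi -> tensor_lift psi X = tensor_lift psi Y) -> X = Y.
Proof.
by move=> XY; rewrite -[X]reprK -[Y]reprK; apply/eqmodP/asboolP.
Qed.

Fact tensor_addA : associative tensor_add.
Proof.
by move=> X Y Z; apply: tensor_ext => H psi b; rewrite !tensor_liftE// addrA.
Qed.

Fact tensor_addC : commutative tensor_add.
Proof.
by move=> X Y; apply: tensor_ext => H psi b; rewrite !tensor_liftE// addrC.
Qed.

Fact tensor_add0 : left_id tensor_zero tensor_add.
Proof.
by move=> X; apply: tensor_ext => H psi b; rewrite !tensor_liftE// add0r.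
Qed.

Fact tensor_addN : left_inverse tensor_zero tensor_opp tensor_add.
Proof.
by move=> X; apply: tensor_ext => H psi b; rewrite !tensor_liftE// addNr.
Qed.

HB.instance Definition _ := GRing.isZmodule.Build fremlin_tensor
  tensor_addA tensor_addC tensor_add0 tensor_addN.

Fact tensor_scaleA a b X :
  tensor_scale a (tensor_scale b X) = tensor_scale (a * b) X.
Proof.
by apply: tensor_ext => H psi c; rewrite !tensor_liftE// scalerA.
Qed.

Fact tensor_scale1 : left_id 1 tensor_scale.
Proof.
by move=> X; apply: tensor_ext => H psi b; rewrite !tensor_liftE// scale1r.
Qed.

Fact tensor_scaleDr : right_distributive tensor_scale +%R.
Proof.
by move=> a X Y; apply: tensor_ext => H psi b; rewrite !tensor_liftE// scalerDr.
Qed.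

Fact tensor_scaleDl X : {morph tensor_scale^~ X : a b / a + b}.
Proof.
by move=> a b; apply: tensor_ext => H psi c; rewrite !tensor_liftE// scalerDl.
Qed.

HB.instance Definition _ := GRing.Zmodule_isLmodule.Build R fremlin_tensor
  tensor_scaleA tensor_scale1 tensor_scaleDr tensor_scaleDl.

Fact tensor_le_refl : reflexive tensor_le.
Proof. by move=> X; apply/asboolP => H psi b. Qed.

Fact tensor_le_anti : antisymmetric tensor_le.
Proof.
move=> X Y /andP[/asboolP XY /asboolP YX]; apply: tensor_ext => H psi b.
by apply: le_anti; rewrite [X in X && _]XY// [X in _ && X]YX.
Qed.

Fact tensor_le_trans : transitive tensor_le.
Proof.
move=> Y X Z /asboolP XY /asboolP YZ; apply/asboolP => H psi b.
exact: le_trans (XY _ _ b) (YZ _ _ b).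
Qed.

HB.instance Definition _ := Order.Le_isPOrder.Build ring_display fremlin_tensor
  tensor_le_refl tensor_le_anti tensor_le_trans.

Lemma tensor_leP X Y :
  reflect (forall (H : archRieszType R) (psi : E -> F -> H),
      riesz_bimorphism psi -> tensor_lift psi X <= tensor_lift psi Y)
    (X <= Y).
Proof. exact: asboolP. Qed.

Fact tensor_join_le X Y Z : (tensor_join X Y <= Z) = (X <= Z) && (Y <= Z).
Proof.
apply/tensor_leP/andP => [h|[/tensor_leP XZ /tensor_leP YZ] H psi b].
  by split; apply/tensor_leP => H psi b; have := h H psi b;
    rewrite tensor_lift_join// vjoin_le => /andP[].
by rewrite tensor_lift_join// vjoin_le XZ ?YZ.
Qed.

Fact tensor_le_meet X Y Z : (Z <= tensor_meet X Y) = (Z <= X) && (Z <= Y).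
Proof.
apply/tensor_leP/andP => [h|[/tensor_leP ZX /tensor_leP ZY] H psi b].
  by split; apply/tensor_leP => H psi b; have := h H psi b;
    rewrite tensor_lift_meet// le_vmeet => /andP[].
by rewrite tensor_lift_meet// le_vmeet ZX ?ZY.
Qed.

Fact tensor_leD2l Z X Y : X <= Y -> Z + X <= Z + Y.
Proof.
move=> /tensor_leP XY; apply/tensor_leP => H psi b.
by rewrite !tensor_liftD// vleD2l// XY.
Qed.

Fact tensor_scale_ge0 (a : R) X : 0 <= a -> 0 <= X -> 0 <= a *: X.
Proof.
move=> a0 /tensor_leP X0; apply/tensor_leP => H psi b.
have := X0 H psi b; rewrite tensor_lift0// tensor_liftZ//; exact: vscale_ge0.
Qed.

HB.instance Definition _ := POrderedLmodule_isRiesz.Build R fremlin_tensor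
  tensor_join_le tensor_le_meet tensor_leD2l tensor_scale_ge0.

Fact tensor_archimedean X Y : (forall n : nat, X *+ n.+1 <= Y) -> X <= 0.
Proof.
move=> XY; apply/tensor_leP => H psi b; rewrite tensor_lift0//.
apply: (varchimedean _ (tensor_lift psi Y)) => n.
have /tensor_leP/(_ H psi b) := XY n; apply: le_trans.
by rewrite -!scaler_nat tensor_liftZ.
Qed.

HB.instance Definition _ :=
  Riesz_isArchimedean.Build R fremlin_tensor tensor_archimedean.

Lemma tensor_lift_hom (H : archRieszType R) (psi : E -> F -> H) :
  riesz_bimorphism psi -> riesz_hom (tensor_lift psi).
Proof.
move=> b; split=> [a X Y|X Y|X Y]; last 2 first.
- exact: tensor_lift_join.
- exact: tensor_lift_meet.
by rewrite tensor_liftD// tensor_liftZ.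
Qed.

Lemma tensor_bimorphism : riesz_bimorphism tensor.
Proof.
have linl y : linear (tensor^~ y).
  move=> a x x'; apply: tensor_ext => H psi b.
  rewrite tensor_liftD// tensor_liftZ// !tensor_lift_gen//.
  by case: b => /(_ y a x x').
have linr x : linear (tensor x).
  move=> a y y'; apply: tensor_ext => H psi b.
  rewrite tensor_liftD// tensor_liftZ// !tensor_lift_gen//.
  by case: b => _ /(_ x a y y').
split=> // [y y0|x x0]; split=> // u v; apply: tensor_ext => H psi b.
- rewrite tensor_lift_join// !tensor_lift_gen//.
  by case: b => _ _ /(_ y y0)[_ /(_ u v)].
- rewrite tensor_lift_meet// !tensor_lift_gen//.
  by case: b => _ _ /(_ y y0)[_ _ /(_ u v)].
- rewrite tensor_lift_join// !tensor_lift_gen//.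
  by case: b => _ _ _ /(_ x x0)[_ /(_ u v)].
- rewrite tensor_lift_meet// !tensor_lift_gen//.
  by case: b => _ _ _ /(_ x x0)[_ _ /(_ u v)].
Qed.

Theorem fremlin_tensorP : is_fremlin_tensor tensor.
Proof.
split=> [|H psi b]; first exact: tensor_bimorphism.
exists (tensor_lift psi); split=> [|T [[linT joinT _] genT]].
  by split=> [|x y]; [exact: tensor_lift_hom|exact: tensor_lift_gen].
have T0 : T 0 = 0.
  by have := linT (- 1) 0 0; rewrite scaler0 addr0 scaleN1r addNr.
have TD X Y : T (X + Y) = T X + T Y.
  by have := linT 1 X Y; rewrite !scale1r.
have TZ a X : T (a *: X) = a *: T X.
  by have := linT a X 0; rewrite T0 !addr0.
suff Tpi : forall s, T (\pi_fremlin_tensor s) = teval psi s.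
  by apply/funext => X; rewrite -[in RHS](reprK X) Tpi.
have pi_eq X (s : texpr) :
    (forall (K : archRieszType R) (phi : E -> F -> K),
       riesz_bimorphism phi -> tensor_lift phi X = teval phi s) -> \pi_fremlin_tensor s = X.
  by move=> h; apply: tensor_ext => K phi bphi; rewrite h// tensor_lift_pi.
elim=> [x y||s IHs t IHt|a s IHs|s IHs t IHt] /=.
- exact: genT.
- exact: T0.
- rewrite (pi_eq (\pi_fremlin_tensor s + \pi_fremlin_tensor t)) ?TD ?IHs ?IHt// => K phi bphi.
  by rewrite tensor_liftD// !tensor_lift_pi.
- rewrite (pi_eq (a *: (\pi_fremlin_tensor s))) ?TZ ?IHs// => K phi bphi.
  by rewrite tensor_liftZ// !tensor_lift_pi.
- rewrite (pi_eq (vjoin (\pi_fremlin_tensor s) (\pi_fremlin_tensor t))).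
    by rewrite joinT IHs IHt.
  by move=> K phi bphi; rewrite tensor_lift_join// !tensor_lift_pi.
Qed.

End FremlinTensor.

Notation "E ⊗ F" := (fremlin_tensor E F) (at level 40, left associativity).

Theorem is_fremlin_tensor_unique (R : realType) (E F G1 G2 : archRieszType R)
    (t1 : E -> F -> G1) (t2 : E -> F -> G2) :
  is_fremlin_tensor t1 -> is_fremlin_tensor t2 ->
  exists f : G1 -> G2,
    [/\ riesz_hom f, bijective f & forall x y, f (t1 x y) = t2 x y].
Proof.
have hom_id (G : rieszType R) : riesz_hom (@id G) by split.
have hom_comp (G1' G2' G3 : rieszType R) (g : G2' -> G3) (f : G1' -> G2') :
    riesz_hom g -> riesz_hom f -> riesz_hom (g \o f).
  move=> [lg jg mg] [lf jf mf]; split=> [a x y|x y|x y] /=.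
  - by rewrite lf lg.
  - by rewrite jf jg.
  - by rewrite mf mg.
move=> [b1 u1] [b2 u2].
have [f [[homf ft] _]] := u1 _ _ b2; have [g [[homg gt] _]] := u2 _ _ b1.
exists f; split=> //; exists g => x.
- have [h [_ hE]] := u1 _ _ b1.
  have gfE : h = g \o f.
    by apply: hE; split=> [|u v /=]; [exact: hom_comp|rewrite ft gt].
  by rewrite -[LHS]/((g \o f) x) -gfE (hE id).
- have [h [_ hE]] := u2 _ _ b2.
  have fgE : h = f \o g.
    by apply: hE; split=> [|u v /=]; [exact: hom_comp|rewrite gt ft].
  by rewrite -[LHS]/((f \o g) x) -fgE (hE id).
Qed.

(* Main.v *)
Require Import Defs.
From HB Require Import structures.
From mathcomp Require Import all_boot all_order all_algebra.
From mathcomp Require Import all_classical all_reals.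
From mathcomp Require Import ring.

Set Implicit Arguments.
Unset Strict Implicit.
Unset Printing Implicit Defensive.

Import Order.TTheory GRing.Theory Num.Theory.
Local Open Scope classical_set_scope.
Local Open Scope ring_scope.

(** Call a positive element thin when no infinite disjoint sequence of nonzero
    positive elements lies below it. Both halves of the proof are about the
    alternative: is every positive element of E thin, or every positive element
    of F, or is there a non-thin element on each side?

    Thinness of x amounts to finite dimension of its principal ideal. If it
    holds throughout E, then every positive element dominates an atom, and E is
    spanned by a maximal disjoint set I of atoms, that is, E ≅ c00 I R
    ([thin_iso_c00]). A Riesz bimorphism on c00 I R × F is a family, indexed by
    I, of Riesz homomorphisms on F with mutually disjoint ranges, and such a
    family has a direct sum on c00 I F; so c00 I F is the tensor product
    ([c00_tensorP]). Suprema in c00 I F are computed at each index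
    ([c00_complete]), so completeness of F passes to it.

    Now let x and y be non-thin. Countable suprema in E and F turn the disjoint
    sequences below them into disjoint sequences of components e_n of x and
    f_m of y ([component_sequence]). The elements e_n ⊗ f_m / (n + m + 1) are
    countably many and bounded by x ⊗ y, but have no supremum
    ([cauchy_family_no_supremum]). Indeed a supremum h agrees with
    e_n ⊗ f_m / (n + m + 1) on the block (n, m), because e_n and f_m are
    components. On the other hand h is the value of a lattice expression in
    finitely many elementary tensors a_i ⊗ b_i. Suppose that real characters
    chi_n of E and xi_m of F take the value 1 at e_n and f_m. Then 1 / (n+m+1)
    is the value of that expression at the numbers chi_n(a_i) xi_m(b_i), hence
    the value of one of finitely many linear pieces, the choice depending on
    (n, m). By the pigeonhole principle a single piece serves a large square
    submatrix, whose rank is then bounded by the length of the piece; but the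
    Cauchy matrix has only invertible square submatrices
    ([teval_not_cauchy]). A matrix of zeros and ones would be a bad choice: the
    identity matrix is (1 - |n - m|)^+, a lattice expression in the sequences n
    and 1.

    Such characters need not exist: a space of measurable functions modulo
    null sets may have none. They do exist generically. Along a decreasing
    sequence of positive elements below e_n, an element z of E tends to a real
    value, measured in units of e_n, as soon as the sequence meets countably
    many dense sets attached to z ([full_limit_value]). No sequence need serve
    all z at once, but for each z the bad sequences form a negligible set, and
    negligible sets are stable under countable unions. Hence the values define
    a Riesz bimorphism from E × F to the functions on pairs of sequences modulo
    negligible sets, which is an Archimedean Riesz space
    ([germ_archimedean]) and therefore a legitimate test for inequalities in
    E ⊗ F. Only countably many equalities are needed about h, so one pair of
    sequences satisfies them all.

    The argument applies to E ⊗ F as well as to the tensor products of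
    principal ideals, so that completeness never has to be carried from
    E ⊗ F to a tensor product of subspaces. *)

(** * Riesz space calculus *)

Section RieszCalculus.
Variables (R : realType) (E : rieszType R).
Implicit Types (x y z u v w : E) (a b : R).

Lemma vle_anti x y : x <= y -> y <= x -> x = y.
Proof. by move=> xy yx; apply: le_anti; rewrite xy yx. Qed.

Lemma vgt0_neq0 x : 0 <= x -> x <> 0 -> 0 < x.
Proof. by move=> x0 /eqP xn; rewrite lt_neqAle eq_sym xn. Qed.

Lemma vmeetl x y : vmeet x y <= x.
Proof. by have := lexx (vmeet x y); rewrite le_vmeet => /andP[]. Qed.

Lemma vmeetr x y : vmeet x y <= y.
Proof. by have := lexx (vmeet x y); rewrite le_vmeet => /andP[]. Qed.

Lemma vjoinC x y : vjoin x y = vjoin y x.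
Proof. by apply: vle_anti; rewrite vjoin_le vjoinl vjoinr. Qed.

Lemma vmeetC x y : vmeet x y = vmeet y x.
Proof. by apply: vle_anti; rewrite le_vmeet vmeetl vmeetr. Qed.

Lemma vle_meet2 x y u v : x <= u -> y <= v -> vmeet x y <= vmeet u v.
Proof.
move=> xu yv; rewrite le_vmeet (le_trans (vmeetl _ _) xu).
by rewrite (le_trans (vmeetr _ _) yv).
Qed.

Lemma vleD2r z x y : x <= y -> x + z <= y + z.
Proof. by rewrite ![_ + z]addrC; apply: vleD2l. Qed.

Lemma vlerBlDr x y z : (x - y <= z) = (x <= z + y).
Proof.
apply/idP/idP => [/(vleD2r y)|/(vleD2r (- y))]; first by rewrite subrK.
by rewrite addrK.
Qed.

Lemma vlerBrDr x y z : (x <= y - z) = (x + z <= y).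
Proof.
apply/idP/idP => [/(vleD2r z)|/(vleD2r (- z))]; first by rewrite subrK.
by rewrite addrK.
Qed.

Lemma vaddr_ge0 x y : 0 <= x -> 0 <= y -> 0 <= x + y.
Proof. by move=> x0 y0; rewrite -[0]addr0 vleD. Qed.

Lemma vle_addr x y : 0 <= y -> x <= x + y.
Proof. by move=> y0; rewrite -[leLHS]addr0 vleD2l. Qed.

Lemma vle_addl x y : 0 <= y -> x <= y + x.
Proof. by rewrite [y + x]addrC; exact: vle_addr. Qed.

Lemma vle_sub x y : 0 <= y -> x - y <= x.
Proof. by move=> y0; rewrite vlerBlDr vle_addr. Qed.

Lemma vjoin_r x y : x <= y -> vjoin x y = y.
Proof. by move=> xy; apply: vle_anti; rewrite ?vjoinr// vjoin_le xy lexx. Qed.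

Lemma vjoin_l x y : y <= x -> vjoin x y = x.
Proof. by rewrite vjoinC; exact: vjoin_r. Qed.

Lemma vmeet_l x y : x <= y -> vmeet x y = x.
Proof. by move=> xy; apply: vle_anti; rewrite ?vmeetl// le_vmeet xy lexx. Qed.

Lemma vjoinDr x y z : vjoin x y + z = vjoin (x + z) (y + z).
Proof.
apply: vle_anti; last by rewrite vjoin_le !vleD2r ?vjoinl ?vjoinr.
by rewrite -vlerBrDr vjoin_le !vlerBrDr vjoinl vjoinr.
Qed.

Lemma vjoinDmeet x y : vjoin x y + vmeet x y = x + y.
Proof.
rewrite vmeetE; apply/eqP; rewrite subr_eq addrC vjoinDr addKr [x + y]addrC.
by rewrite addKr vjoinC.
Qed.

Lemma vmeetDr x y z : vmeet x y + z = vmeet (x + z) (y + z).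
Proof.
by rewrite !vmeetE !opprD -vjoinDr opprD opprK.
Qed.

Lemma vmeetD_le x y z : 0 <= x -> 0 <= y -> 0 <= z ->
  vmeet (x + y) z <= vmeet x z + vmeet y z.
Proof.
move=> x0 y0 z0; have mz : vmeet (x + y) z <= z := vmeetr _ _.
have yz0 : 0 <= vmeet y z by rewrite le_vmeet y0.
rewrite vmeetDr le_vmeet; apply/andP; split; last exact: le_trans mz (vle_addr _ _).
rewrite [leRHS]addrC vmeetDr le_vmeet [y + x]addrC vmeetl /=.
exact: le_trans mz (vle_addr _ _).
Qed.

Lemma vmeetZ_le b x y : 0 < b -> vmeet (b *: x) (b *: y) <= b *: vmeet x y.
Proof.
move=> b0; have bK z : z = b *: (b^-1 *: z).
  by rewrite scalerA divff ?scale1r// gt_eqF.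
have bi : 0 <= b^-1 by rewrite invr_ge0 ltW.
rewrite [leLHS]bK; apply: (vleZ (ltW b0)); rewrite le_vmeet.
have sK z : b^-1 *: (b *: z) = z by rewrite scalerA mulVf ?scale1r// gt_eqF.
by apply/andP; split; rewrite -[leRHS]sK; apply: (vleZ bi); rewrite ?vmeetl ?vmeetr.
Qed.

(** Disjointness of positive elements. The equation alone forces both to be
    positive. *)
Definition disj x y := vmeet x y = 0.

Lemma disj_sym x y : disj x y -> disj y x.
Proof. by rewrite /disj vmeetC. Qed.

Lemma disj_ge0l x y : disj x y -> 0 <= x.
Proof. by move=> <-; exact: vmeetl. Qed.

Lemma disj_ge0r x y : disj x y -> 0 <= y.
Proof. by move=> <-; exact: vmeetr. Qed.

Lemma disj_le u x y : 0 <= u -> u <= x -> disj x y -> disj u y.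
Proof.
move=> u0 ux xy; have y0 := disj_ge0r xy.
apply: vle_anti; last by rewrite le_vmeet u0.
by rewrite -[leRHS]xy vle_meet2.
Qed.

Lemma disj_le2 u v x y : 0 <= u -> u <= x -> 0 <= v -> v <= y ->
  disj x y -> disj u v.
Proof.
by move=> u0 ux v0 vy xy; apply/(disj_le u0 ux)/disj_sym/(disj_le v0 vy)/disj_sym.
Qed.

Lemma disjD x y z : disj x z -> disj y z -> disj (x + y) z.
Proof.
move=> xz yz; have [[x0 y0] z0] := (disj_ge0l xz, disj_ge0l yz, disj_ge0r xz).
apply: vle_anti; last by rewrite le_vmeet vaddr_ge0.
by rewrite (le_trans (vmeetD_le _ _ _))// xz yz addr0.
Qed.

Lemma disjZ a x z : 0 <= a -> disj x z -> disj (a *: x) z.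
Proof.
move=> a0 xz; have [x0 z0] := (disj_ge0l xz, disj_ge0r xz).
apply: (@disj_le2 _ _ ((a + 1) *: x) ((a + 1) *: z)) => //.
- exact: vscale_ge0.
- by rewrite scalerDl scale1r vle_addr.
- by rewrite scalerDl scale1r vle_addl// vscale_ge0.
- apply: vle_anti; last by rewrite le_vmeet !vscale_ge0 ?addr_ge0.
  by rewrite (le_trans (vmeetZ_le _ _ _)) ?xz ?scaler0 ?ltr_wpDl.
Qed.

Lemma disj0 x : 0 <= x -> disj 0 x.
Proof. exact: vmeet_l. Qed.

Lemma disjxx x : disj x x -> x = 0.
Proof. by rewrite /disj vmeet_l. Qed.

Lemma disj_join x y : disj x y -> vjoin x y = x + y.
Proof. by move=> xy; rewrite -vjoinDmeet xy addr0. Qed.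

Lemma disj_addr_le x y z : disj x y -> x <= z -> y <= z -> x + y <= z.
Proof. by move=> /disj_join <- xz yz; rewrite vjoin_le xz. Qed.

Lemma disj_sum (I : Type) (r : seq I) (P : pred I) (f : I -> E) z : 0 <= z ->
  (forall i, P i -> disj (f i) z) -> disj (\sum_(i <- r | P i) f i) z.
Proof.
by move=> z0 h; elim/big_rec: _ => [|i y Pi yz]; [exact: disj0|exact: disjD (h _ Pi) yz].
Qed.

Lemma vsumr_ge0 (I : Type) (r : seq I) (P : pred I) (f : I -> E) :
  (forall i, P i -> 0 <= f i) -> 0 <= \sum_(i <- r | P i) f i.
Proof.
by move=> h; elim/big_rec: _ => // i y Pi y0; rewrite vaddr_ge0 ?h.
Qed.

(** The sum of disjoint positive elements is their supremum. *)
Lemma disj_sum_le (I : eqType) (r : seq I) (f : I -> E) z : uniq r -> 0 <= z ->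
  (forall i j, i \in r -> j \in r -> i != j -> disj (f i) (f j)) ->
  (forall i, i \in r -> 0 <= f i <= z) -> \sum_(i <- r) f i <= z.
Proof.
move=> ur z0; elim: r ur => [|i r IH] /=; first by rewrite big_nil.
move=> /andP[ir ur] dis fz; rewrite big_cons.
have /andP[fi0 fiz] := fz i (mem_head _ _).
apply: disj_addr_le => //; last first.
  apply: IH => // [j k jr kr jk|j jr]; last by rewrite fz// inE jr orbT.
  by apply: dis; rewrite // inE ?jr ?kr orbT.
apply: disj_sym; rewrite big_seq_cond; apply: disj_sum => // j; rewrite andbT => jr.
apply: dis; rewrite ?inE ?eqxx ?jr ?orbT//.
by apply: contraNneq ir => <-.
Qed.

Definition vpos x := vjoin x 0.

Lemma vpos_ge0 x : 0 <= vpos x. Proof. exact: vjoinr. Qed.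

Lemma vpos_ge x : x <= vpos x. Proof. exact: vjoinl. Qed.

Lemma vpos_le x y : (vpos x <= y) = (x <= y) && (0 <= y).
Proof. exact: vjoin_le. Qed.

Lemma vpos_id x : 0 <= x -> vpos x = x.
Proof. exact: vjoin_l. Qed.

Lemma vposBneg x : vpos x - vpos (- x) = x.
Proof.
apply/eqP; rewrite subr_eq; apply/eqP.
by rewrite addrC /vpos vjoinDr addNr add0r vjoinC.
Qed.

Lemma vpos_neg_disj x : disj (vpos x) (vpos (- x)).
Proof.
have <- : x + vpos (- x) = vpos x.
  by rewrite -{1}[x]vposBneg subrK.
rewrite /disj -{2}[vpos (- x)]add0r -vmeetDr vmeetE oppr0; exact: addNr.
Qed.

Lemma vpos_disjB x y : disj x y -> vpos (x - y) = x.
Proof.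
move=> xy; rewrite /vpos -[0](subrr y) -vjoinDr disj_join//.
by rewrite addrK.
Qed.

Lemma vposD x y : vpos (x + y) <= vpos x + vpos y.
Proof. by rewrite vpos_le vleD ?vpos_ge// vaddr_ge0 ?vpos_ge0. Qed.

Lemma vle_pos x y : x <= y -> vpos x <= vpos y.
Proof. by move=> xy; rewrite vpos_le vpos_ge0 (le_trans xy) ?vpos_ge. Qed.

Lemma vjoin_pos x y : vjoin x y = vpos (x - y) + y.
Proof. by rewrite vjoinDr subrK add0r. Qed.

Lemma vposZ a x : 0 <= a -> vpos (a *: x) <= a *: vpos x.
Proof. by move=> a0; rewrite vpos_le vleZ ?vpos_ge// vscale_ge0 ?vpos_ge0. Qed.

Lemma vabs_id x : 0 <= x -> vabs x = x.
Proof. by move=> x0; rewrite /vabs vjoin_l// (le_trans _ x0)// vleNl oppr0. Qed.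

(** If z is disjoint from a set, subtracting its overlap with the supremum
    gives another upper bound. *)
Lemma disj_supremum (S : set E) h z : S !=set0 -> supremums S h ->
  (forall s, S s -> disj s z) -> disj h z.
Proof.
move=> [s0 Ss0] [hub hmin] dis; set w := vmeet h z.
have z0 := disj_ge0r (dis _ Ss0).
have h0 : 0 <= h by rewrite (le_trans (disj_ge0l (dis _ Ss0)))// hub.
have w0 : 0 <= w by rewrite le_vmeet h0.
suff /hmin : ubound S (h - w).
  rewrite vlerBrDr -[leRHS]addr0 => /(vleD2l (- h)); rewrite !addKr => w_le0.
  exact: vle_anti.
move=> s Ss; rewrite vlerBrDr; apply: disj_addr_le; rewrite ?vmeetl ?hub//.
by apply/disj_sym/(disj_le w0 (vmeetr _ _))/disj_sym/dis.
Qed.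

End RieszCalculus.

Section LinearFacts.
Variables (R : realType) (V W : lmodType R) (f : V -> W).
Hypothesis fL : linear f.

Lemma lin0 : f 0 = 0.
Proof. by have := fL (- 1) 0 0; rewrite scaler0 addr0 scaleN1r addNr. Qed.

Lemma linD x y : f (x + y) = f x + f y.
Proof. by have := fL 1 x y; rewrite !scale1r. Qed.

Lemma linZ a x : f (a *: x) = a *: f x.
Proof. by have := fL a x 0; rewrite lin0 !addr0. Qed.

Lemma linN x : f (- x) = - f x.
Proof. by rewrite -scaleN1r linZ scaleN1r. Qed.

Lemma linB x y : f (x - y) = f x - f y.
Proof. by rewrite linD linN. Qed.

Lemma lin_sum (I : Type) (r : seq I) (P : pred I) (g : I -> V) :
  f (\sum_(i <- r | P i) g i) = \sum_(i <- r | P i) f (g i).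
Proof. by apply: (big_morph f linD lin0). Qed.

End LinearFacts.

Section RieszHom.
Variables (R : realType).
Implicit Types E F G : rieszType R.

Lemma riesz_hom_ge0 E F (f : E -> F) x : riesz_hom f -> 0 <= x -> 0 <= f x.
Proof.
move=> [fL fJ _] x0; have := fJ x 0; rewrite vjoin_l// (lin0 fL) => ->.
exact: vjoinr.
Qed.

Lemma riesz_hom_le E F (f : E -> F) x y : riesz_hom f -> x <= y -> f x <= f y.
Proof.
move=> fh xy; have [fL _ _] := fh.
by rewrite -vsub_ge0 -(linB fL); apply: riesz_hom_ge0 => //; rewrite vsub_ge0.
Qed.

Lemma riesz_hom_disj E F (f : E -> F) x y :
  riesz_hom f -> disj x y -> disj (f x) (f y).
Proof. by move=> [fL _ fM] xy; rewrite /disj -fM xy (lin0 fL). Qed.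

Lemma join_riesz_hom E F (f : E -> F) :
  linear f -> {morph f : x y / vjoin x y} -> riesz_hom f.
Proof.
by move=> fL fJ; split=> // x y; rewrite !vmeetE (linN fL) fJ !(linN fL).
Qed.

(** x \/ y is y + (x - y)^+, and preserving disjointness is enough to preserve
    positive parts: z = z^+ - z^- is the only way to write z as a difference of
    two disjoint elements. *)
Lemma disj_riesz_hom E F (f : E -> F) : linear f ->
  (forall x y, disj x y -> disj (f x) (f y)) -> riesz_hom f.
Proof.
move=> fL fd; apply: join_riesz_hom => // x y.
rewrite !vjoin_pos (linD fL) -(linB fL); congr (_ + _).
have d := fd _ _ (vpos_neg_disj (x - y)).
by rewrite -[in LHS](vpos_disjB d) -(linB fL) vposBneg.
Qed.

Lemma riesz_hom_comp E F G (g : F -> G) (f : E -> F) :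
  riesz_hom g -> riesz_hom f -> riesz_hom (g \o f).
Proof.
move=> [lg jg mg] [lf jf mf]; split=> [a x y|x y|x y] /=.
- by rewrite lf lg.
- by rewrite jf jg.
- by rewrite mf mg.
Qed.

Lemma riesz_iso_sym E F : E ≅ F -> F ≅ E.
Proof.
move=> [f [[fL fJ fM] [g fK gK]]]; exists g; split; last by exists f.
by split=> [a x y|x y|x y]; apply: (can_inj fK); rewrite gK ?fL ?fJ ?fM !gK.
Qed.

Lemma riesz_iso_trans E F G : E ≅ F -> F ≅ G -> E ≅ G.
Proof.
move=> [f [fh fb]] [g [gh gb]]; exists (g \o f); split; first exact: riesz_hom_comp.
exact: bij_comp.
Qed.

Lemma riesz_hom_reflect_le E F (f : E -> F) x y :
  riesz_hom f -> injective f -> (f x <= f y) = (x <= y).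
Proof.
move=> fh fI; apply/idP/idP => [fxy|]; last exact: riesz_hom_le.
have [_ fJ _] := fh.
have -> : y = vjoin x y by apply: fI; rewrite fJ vjoin_r.
exact: vjoinl.
Qed.

End RieszHom.

(** * Reduced powers of the real line *)

(** A set is full when its complement is negligible. Countable intersections
    will make reduced powers Archimedean, and properness will give points. *)
Record sigma_filter (X : Type) := SigmaFilter {
  full :> set X -> Prop;
  fullT : full setT;
  full_sub : forall A B, A `<=` B -> full A -> full B;
  full_bigcap : forall B : nat -> set X,
    (forall k, full (B k)) -> full (\bigcap_k B k);
  full_proper : ~ full set0
}.

Section SigmaFilterTheory.
Variables (X : Type) (U : sigma_filter X).

Lemma fullI (A B : set X) : U A -> U B -> U (A `&` B).
Proof.
move=> UA UB; pose C k := if k is 0%N then A else B.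
apply: (@full_sub _ _ (\bigcap_k C k)); last by apply: full_bigcap => -[].
by move=> w Cw; split; [exact: (Cw 0%N)|exact: (Cw 1%N)].
Qed.

Lemma full_all (A : set X) : (forall w, A w) -> U A.
Proof. by move=> h; apply: full_sub (fullT U) => w _. Qed.

Lemma full_imp (A B : set X) : (forall w, A w -> B w) -> U A -> U B.
Proof. exact: full_sub. Qed.

Lemma full_nonempty (A : set X) : U A -> exists w, A w.
Proof.
move=> UA; apply: contrapT => nA; apply: (@full_proper _ U).
by apply: full_sub UA => w Aw; apply: nA; exists w.
Qed.

End SigmaFilterTheory.

Section FubiniProduct.
Variables (X Y : Type) (U : sigma_filter X) (V : sigma_filter Y).

(** Iterating the two filters, as in Fubini's theorem, needs no measurability
    and keeps countable intersections. *)
Definition fubini_full (T : set (X * Y)) := U [set w | V [set v | T (w, v)]].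

Fact fubini_fullT : fubini_full setT.
Proof. by apply: full_all => w; exact: full_all. Qed.

Fact fubini_full_sub (A B : set (X * Y)) :
  A `<=` B -> fubini_full A -> fubini_full B.
Proof.
by move=> AB; apply: full_imp => w; apply: full_imp => v; exact: AB.
Qed.

Fact fubini_full_bigcap (B : nat -> set (X * Y)) :
  (forall k, fubini_full (B k)) -> fubini_full (\bigcap_k B k).
Proof.
move=> /full_bigcap; apply: full_imp => w Bw.
have : V (\bigcap_k [set v | B k (w, v)]) by apply: full_bigcap => k; exact: Bw.
by apply: full_imp => v Bv k _; exact: Bv.
Qed.

Fact fubini_full_proper : ~ fubini_full set0.
Proof. by move=> /full_nonempty[w /= /full_nonempty[v []]]. Qed.

Definition fubini : sigma_filter (X * Y) := SigmaFilter
  fubini_fullT fubini_full_sub fubini_full_bigcap fubini_full_proper.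

Lemma fubinil (A : set X) : U A -> fubini [set w | A w.1].
Proof. by apply: full_imp => w Aw; apply: (@full_all _ V). Qed.

Lemma fubinir (B : set Y) : V B -> fubini [set w | B w.2].
Proof. by move=> VB; apply: (@full_all _ U) => w; apply: full_imp VB. Qed.

End FubiniProduct.

Section ReducedPower.
Local Open Scope quotient_scope.
Variables (R : realType) (X : Type) (U : sigma_filter X).
Implicit Types f g h : X -> R.

Definition aeq f g : bool := `[< U [set w | f w = g w] >].

Fact aeq_refl : reflexive aeq.
Proof. by move=> f; apply/asboolP/full_all. Qed.

Fact aeq_sym : symmetric aeq.
Proof.
by move=> f g; apply/asboolP/asboolP; apply: full_imp => w /= ->.
Qed.

Fact aeq_trans : transitive aeq.
Proof.
move=> g f h /asboolP fg /asboolP gh; apply/asboolP.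
by apply: full_imp (fullI fg gh) => w [/= -> ->].
Qed.

Canonical aeq_equiv := EquivRel aeq aeq_refl aeq_sym aeq_trans.

(** This is an Archimedean Riesz space in which an identity has to
    be checked only almost everywhere; it is the target of the bimorphisms used
    to test inequalities in a tensor product. *)
Definition reduced_power := {eq_quot aeq}.

HB.instance Definition _ := Choice.on reduced_power.
HB.instance Definition _ := EqQuotient.on reduced_power.

Implicit Types x y z : reduced_power.

Definition germ f : reduced_power := \pi_reduced_power f.

Lemma germK x : germ (repr x) = x.
Proof. exact: reprK. Qed.

Lemma germP f g : germ f = germ g <-> U [set w | f w = g w].
Proof.
by split=> [/eqmodP/asboolP//|h]; apply/eqmodP/asboolP.
Qed.

Lemma repr_germ f : U [set w | repr (germ f) w = f w].
Proof. by apply/germP; rewrite germK. Qed.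

Definition germ_map2 (op : R -> R -> R) x y :=
  germ (fun w => op (repr x w) (repr y w)).

Lemma germ_map2E op f g :
  germ_map2 op (germ f) (germ g) = germ (fun w => op (f w) (g w)).
Proof.
apply/germP; apply: full_imp (fullI (repr_germ f) (repr_germ g)).
by move=> w [/= -> ->].
Qed.

Definition germ_scale (a : R) x := germ (fun w => a * repr x w).

Lemma germ_scaleE a f : germ_scale a (germ f) = germ (fun w => a * f w).
Proof. by apply/germP; apply: full_imp (repr_germ f) => w /= ->. Qed.

Definition germ_le x y : bool := `[< U [set w | repr x w <= repr y w] >].

Lemma germ_leE f g : germ_le (germ f) (germ g) = `[< U [set w | f w <= g w] >].
Proof.
apply/asboolP/asboolP; have fg := fullI (repr_germ f) (repr_germ g).
  by move=> /(fullI fg); apply: full_imp => w [/= [-> ->]].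
by move=> /(fullI fg); apply: full_imp => w [/= [-> ->]].
Qed.

Let germE := (germ_map2E, germ_scaleE, germ_leE).

Fact germ_addA : associative (germ_map2 +%R).
Proof.
move=> x y z; rewrite -[x]germK -[y]germK -[z]germK !germE.
by congr germ; apply/funext => w; rewrite addrA.
Qed.

Fact germ_addC : commutative (germ_map2 +%R).
Proof.
move=> x y; rewrite -[x]germK -[y]germK !germE.
by congr germ; apply/funext => w; rewrite addrC.
Qed.

Fact germ_add0 : left_id (germ (fun=> 0)) (germ_map2 +%R).
Proof.
move=> x; rewrite -[x]germK !germE.
by congr germ; apply/funext => w; rewrite add0r.
Qed.

Fact germ_addN : left_inverse (germ (fun=> 0)) (germ_scale (-1)) (germ_map2 +%R).
Proof.
move=> x; rewrite -[x]germK !germE.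
by congr germ; apply/funext => w; rewrite mulN1r addNr.
Qed.

HB.instance Definition _ := GRing.isZmodule.Build reduced_power
  germ_addA germ_addC germ_add0 germ_addN.

Fact germ_scaleA a b x : germ_scale a (germ_scale b x) = germ_scale (a * b) x.
Proof.
rewrite -[x]germK !germE.
by congr germ; apply/funext => w; rewrite mulrA.
Qed.

Fact germ_scale1 : left_id 1 germ_scale.
Proof.
move=> x; rewrite -[x]germK !germE.
by congr germ; apply/funext => w; rewrite mul1r.
Qed.

Fact germ_scaleDr : right_distributive germ_scale (germ_map2 +%R).
Proof.
move=> a x y; rewrite -[x]germK -[y]germK !germE.
by congr germ; apply/funext => w; rewrite mulrDr.
Qed.

Fact germ_scaleDl x : {morph germ_scale^~ x : a b / a + b >-> germ_map2 +%R a b}.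
Proof.
move=> a b; rewrite -[x]germK !germE.
by congr germ; apply/funext => w; rewrite mulrDl.
Qed.

HB.instance Definition _ := GRing.Zmodule_isLmodule.Build R reduced_power
  germ_scaleA germ_scale1 germ_scaleDr germ_scaleDl.

Fact germ_le_refl : reflexive germ_le.
Proof. by move=> x; apply/asboolP; apply: full_all => w /=; exact: lexx. Qed.

Fact germ_le_anti : antisymmetric germ_le.
Proof.
move=> x y; rewrite -[x]germK -[y]germK !germE => /andP[/asboolP xy /asboolP yx].
apply/germP; apply: full_imp (fullI xy yx) => w [/= h1 h2].
by apply: le_anti; rewrite h1 h2.
Qed.

Fact germ_le_trans : transitive germ_le.
Proof.
move=> y x z /asboolP xy /asboolP yz; apply/asboolP.
by apply: full_imp (fullI xy yz) => w [/=]; exact: le_trans.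
Qed.

HB.instance Definition _ := Order.Le_isPOrder.Build ring_display reduced_power
  germ_le_refl germ_le_anti germ_le_trans.

Lemma le_germ f g : germ f <= germ g <-> U [set w | f w <= g w].
Proof.
by split=> [|h]; rewrite [_ <= _]germ_leE; [move/asboolP|apply/asboolP].
Qed.

Fact germ_join_le x y z : (germ_map2 Num.max x y <= z) = (x <= z) && (y <= z).
Proof.
rewrite -[x]germK -[y]germK -[z]germK !germE; apply/idP/andP.
  move=> /le_germ h; split; apply/le_germ; apply: full_imp h => w /=;
  by rewrite ge_max => /andP[].
move=> [/le_germ h1 /le_germ h2]; apply/le_germ.
by apply: full_imp (fullI h1 h2) => w [/=]; rewrite ge_max => -> ->.
Qed.

Fact germ_le_meet x y z : (z <= germ_map2 Num.min x y) = (z <= x) && (z <= y).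
Proof.
rewrite -[x]germK -[y]germK -[z]germK !germE; apply/idP/andP.
  move=> /le_germ h; split; apply/le_germ; apply: full_imp h => w /=;
  by rewrite le_min => /andP[].
move=> [/le_germ h1 /le_germ h2]; apply/le_germ.
by apply: full_imp (fullI h1 h2) => w [/=]; rewrite le_min => -> ->.
Qed.

Lemma germD f g : germ f + germ g = germ (fun w => f w + g w).
Proof. exact: germ_map2E. Qed.

Lemma germZ a f : a *: germ f = germ (fun w => a * f w).
Proof. exact: germ_scaleE. Qed.

Fact germ_leD2l z x y : x <= y -> z + x <= z + y.
Proof.
rewrite -[x]germK -[y]germK -[z]germK !germD => /le_germ h; apply/le_germ.
by apply: full_imp h => w /=; rewrite lerD2l.
Qed.

Fact germ_scale_ge0 (a : R) x : 0 <= a -> 0 <= x -> 0 <= a *: x.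
Proof.
rewrite -[x]germK germZ => a0 /le_germ h; apply/le_germ.
by apply: full_imp h => w /=; exact: mulr_ge0.
Qed.

HB.instance Definition _ := POrderedLmodule_isRiesz.Build R reduced_power
  germ_join_le germ_le_meet germ_leD2l germ_scale_ge0.

Lemma germ_join f g : vjoin (germ f) (germ g) = germ (fun w => Num.max (f w) (g w)).
Proof. exact: germ_map2E. Qed.

(** This is where closure under countable intersections is used: the
    exceptional sets of the countably many hypotheses are merged. *)
Fact germ_archimedean x y : (forall n : nat, x *+ n.+1 <= y) -> x <= 0.
Proof.
rewrite -[x]germK -[y]germK => h; apply/le_germ.
have /full_bigcap : forall n, U [set w | n.+1%:R * repr x w <= repr y w].
  by move=> n; have := h n; rewrite -scaler_nat germZ => /le_germ.
apply: full_imp => w hw; apply: (@varchimedean R R^o _ (repr y w)) => n.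
by have := hw n I; rewrite /= mulr_natl.
Qed.

HB.instance Definition _ :=
  Riesz_isArchimedean.Build R reduced_power germ_archimedean.

End ReducedPower.

(** * Generic characters *)

Lemma full_countable (X : Type) (U : sigma_filter X) (J : countType)
  (B : J -> set X) : (forall j, U (B j)) -> U [set w | forall j, B j w].
Proof.
move=> UB.
have : U (\bigcap_k (if unpickle k is Some j then B j else setT)).
  by apply: full_bigcap => k; case: unpickle => [j|]; [exact: UB|exact: fullT].
by apply: full_imp => w Bw j; have := Bw (pickle j) I; rewrite pickleK.
Qed.

Section GenericSequences.
Variables (T : Type) (le : T -> T -> Prop) (t0 : T).

Definition dense (D : set T) := forall t, exists2 t', le t' t & D t'.

Definition meets (D : nat -> set T) (s : nat -> T) :=
  (forall i, le (s i.+1) (s i)) /\ forall k, exists i, D k (s i).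

(** Comeagre sets in the sense of forcing: the poset stands for a base of open
    sets and a decreasing sequence for a point. *)
Definition generic_full (A : set (nat -> T)) :=
  exists2 D : nat -> set T, (forall k, dense (D k)) &
    forall s, meets D s -> A s.

Hypothesis le_refl : forall t, le t t.

Fact generic_fullT : generic_full setT.
Proof. by exists (fun=> setT) => // k t; exists t. Qed.

Fact generic_full_sub A B : A `<=` B -> generic_full A -> generic_full B.
Proof. by move=> AB [D Dd DA]; exists D => // s /DA/AB. Qed.

Fact generic_full_bigcap (B : nat -> set (nat -> T)) :
  (forall k, generic_full (B k)) -> generic_full (\bigcap_k B k).
Proof.
move=> /(_ _)/cid2-/all_sig2[D Dd DB].
exists (fun k => if unpickle k is Some (j, l) then D j l else setT) => [k|s [sle sD]].
  by case: unpickle => [[j l]|]; [exact: Dd|move=> t; exists t].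
move=> j _; apply: DB; split=> // l.
by have := sD (pickle (j, l)); rewrite pickleK.
Qed.

(** As in Baire's theorem, the k-th dense set is met at the k-th step. *)
Fact generic_full_proper : ~ generic_full set0.
Proof.
move=> [D Dd D0].
have [f fle fD] := all_sig2 (fun kt => cid2 (Dd kt.1 kt.2)).
pose s := fix s i := if i is j.+1 then f (j.+1, s j) else f (0%N, t0).
apply: (D0 s); split=> [i|[|k]]; first exact: fle.
  by exists 0%N; exact: (fD (0%N, t0)).
by exists k.+1; exact: (fD (k.+1, s k)).
Qed.

Definition generic_filter : sigma_filter (nat -> T) := SigmaFilter
  generic_fullT generic_full_sub generic_full_bigcap generic_full_proper.

Lemma generic_desc : generic_filter [set s | forall i, le (s i.+1) (s i)].
Proof. by exists (fun=> setT) => [k t|s []//]; exists t. Qed.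

Lemma generic_dense D : dense D -> generic_filter [set s | exists i, D (s i)].
Proof. by move=> Dd; exists (fun=> D) => // s [_ /(_ 0%N)]. Qed.

End GenericSequences.

Section LocalSign.
Variables (R : realType) (E : archRieszType R).
Implicit Types (x y z p q e : E) (a b l m r t : R).

(** z >= 0 on the band generated by p, expressed without the projection onto
    that band, which need not exist. *)
Definition nonneg_on p z := disj (vpos (- z)) p.

Lemma nonneg_on_mono p y z : 0 <= p -> y <= z -> nonneg_on p y -> nonneg_on p z.
Proof.
move=> p0 yz; apply: disj_le; first exact: vpos_ge0.
by apply: vle_pos; rewrite vleN2.
Qed.

Lemma ge0_nonneg_on p z : 0 <= p -> 0 <= z -> nonneg_on p z.
Proof.
move=> p0 z0; apply: (nonneg_on_mono p0 z0).
by rewrite /nonneg_on oppr0 vpos_id//; exact: disj0.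
Qed.

Lemma nonneg_onD p y z : nonneg_on p y -> nonneg_on p z -> nonneg_on p (y + z).
Proof.
move=> py pz; apply: disj_le (disjD py pz); first exact: vpos_ge0.
by rewrite opprD vposD.
Qed.

Lemma nonneg_onZ p a z : 0 <= a -> nonneg_on p z -> nonneg_on p (a *: z).
Proof.
move=> a0 pz; apply: disj_le (disjZ a0 pz); first exact: vpos_ge0.
by rewrite -scalerN vposZ.
Qed.

Lemma nonneg_on_sub p q z : 0 <= q -> q <= p -> nonneg_on p z -> nonneg_on q z.
Proof. by move=> q0 qp /disj_sym pz; apply/disj_sym; exact: disj_le qp pz. Qed.

Lemma nonneg_on_absurd p e a : 0 < p -> p <= e -> a < 0 -> ~ nonneg_on p (a *: e).
Proof.
move=> p0 pe a0; rewrite /nonneg_on -scaleNr.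
have na0 : 0 < - a by rewrite oppr_gt0.
have e0 : 0 <= e := le_trans (ltW p0) pe.
rewrite vpos_id ?vscale_ge0 ?(ltW na0)// => d.
have /ltW ia : 0 < (- a)^-1 by rewrite invr_gt0.
have := disjZ ia d; rewrite scalerA mulVf ?gt_eqF// scale1r => /(disj_le (ltW p0) pe).
by move=> /disjxx pE; rewrite pE ltxx in p0.
Qed.

(** z is positive on the part of p that lies below z^+. *)
Lemma nonneg_on_dense p z : 0 < p -> ~ disj (vpos z) p ->
  exists2 q, 0 < q <= p & nonneg_on q z.
Proof.
move=> p0 np; exists (vmeet (vpos z) p).
  by rewrite vmeetr andbT vgt0_neq0// le_vmeet vpos_ge0 ltW.
apply/disj_sym/(disj_le _ (vmeetl _ _))/vpos_neg_disj.
by rewrite le_vmeet vpos_ge0 ltW.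
Qed.

Lemma sign_dichotomy p z : 0 < p ->
  exists2 q, 0 < q <= p & nonneg_on q z \/ nonneg_on q (- z).
Proof.
move=> p0; have [d|/(nonneg_on_dense p0)[q qp qz]] := pselect (disj (vpos z) p).
  by exists p; rewrite ?p0 ?lexx//; right; rewrite /nonneg_on opprK.
by exists q => //; left.
Qed.

(** Otherwise n p <= z^+ for every n, against the Archimedean axiom. *)
Lemma locally_bounded p e z : 0 < p -> p <= e ->
  exists n : nat, exists2 q, 0 < q <= p & nonneg_on q (n%:R *: e - z).
Proof.
move=> p0 pe; apply: contrapT => nb.
suff : p <= 0 by move=> /(lt_le_trans p0); rewrite ltxx.
apply: (@varchimedean _ _ _ (vpos z)) => n.
have d : disj (vpos (n.+1%:R *: e - z)) p.
  apply: contrapT => /(nonneg_on_dense p0)[q qp qz]; apply: nb.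
  by exists n.+1; exists q.
set w := vpos (p *+ n.+1 - vpos z).
have w0 : w = 0.
  apply: disjxx; apply: (@disj_le2 _ _ _ _ (vpos (n.+1%:R *: e - z)) (n.+1%:R *: p));
    rewrite ?vpos_ge0//.
  - apply: vle_pos; apply: vleD; last by rewrite vleN2 vpos_ge.
    by rewrite -scaler_nat; apply: vleZ.
  - rewrite vpos_le scaler_nat vle_sub ?vpos_ge0//= -scaler_nat.
    by rewrite vscale_ge0// ltW.
  - by apply/disj_sym/disjZ => //; exact/disj_sym.
by rewrite -vsub_ge0 -vleN2 opprB oppr0 -w0 vpos_ge.
Qed.

End LocalSign.

Section GenericCharacters.
Variables (R : realType) (E : archRieszType R) (e : nat -> E).
Hypothesis e_gt0 : forall n, 0 < e n.
Implicit Types (x y z p q : E) (a b l m r t : R) (n i j : nat).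

(** All the indices are treated in one condition, so that a single generic
    sequence carries a character for each e n. *)
Definition condition := {f : nat -> E | forall n, 0 < f n <= e n}.

Definition refines (P Q : condition) := forall n, sval P n <= sval Q n.

Fact top_condition_proof n : 0 < e n <= e n.
Proof. by rewrite e_gt0 lexx. Qed.

Definition top_condition : condition :=
  exist (fun f => forall n, 0 < f n <= e n) e top_condition_proof.

Fact refines_refl P : refines P P.
Proof. by move=> n; exact: lexx. Qed.

Definition character_filter := generic_filter top_condition refines_refl.

Implicit Types s : nat -> condition.

Definition stage s i n := sval (s i) n.

Definition descending s := forall i, refines (s i.+1) (s i).

Lemma stage_gt0 s i n : 0 < stage s i n.
Proof. by rewrite /stage; case: (s i) => f /= /(_ n)/andP[]. Qed.

Lemma stage_le s i n : stage s i n <= e n.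
Proof. by rewrite /stage; case: (s i) => f /= /(_ n)/andP[]. Qed.

Lemma stage_anti s i j n : descending s -> (i <= j)%N -> stage s j n <= stage s i n.
Proof.
move=> ds /subnK <-; elim: (j - i)%N => [|k IH]; first exact: lexx.
by apply: le_trans (ds _ n) IH.
Qed.

Definition eventually_nonneg s n z := exists i, nonneg_on (stage s i n) z.

Lemma eventually_at s n z : descending s -> eventually_nonneg s n z ->
  exists i, forall j, (i <= j)%N -> nonneg_on (stage s j n) z.
Proof.
move=> ds [i zi]; exists i => j ij.
by apply: nonneg_on_sub zi; [exact/ltW/stage_gt0|exact: stage_anti].
Qed.

Lemma eventuallyD s n y z : descending s ->
  eventually_nonneg s n y -> eventually_nonneg s n z ->
  eventually_nonneg s n (y + z).
Proof.
move=> ds /(eventually_at ds)[i yi] /(eventually_at ds)[j zj].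
by exists (maxn i j); apply: nonneg_onD; rewrite ?yi ?zj ?leq_maxl ?leq_maxr//;
  [apply: yi|apply: zj]; rewrite ?leq_maxl ?leq_maxr.
Qed.

Lemma eventuallyZ s n a z : 0 <= a ->
  eventually_nonneg s n z -> eventually_nonneg s n (a *: z).
Proof. by move=> a0 [i zi]; exists i; apply: nonneg_onZ. Qed.

Lemma eventually_mono s n y z : y <= z ->
  eventually_nonneg s n y -> eventually_nonneg s n z.
Proof.
by move=> yz [i yi]; exists i; apply: nonneg_on_mono yi => //; exact/ltW/stage_gt0.
Qed.

Lemma eventually_ge0 s n z : 0 <= z -> eventually_nonneg s n z.
Proof. by move=> z0; exists 0%N; apply: ge0_nonneg_on => //; exact/ltW/stage_gt0. Qed.

Lemma eventually_disj s n z : disj (vpos (- z)) (e n) -> eventually_nonneg s n z.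
Proof.
move=> d; exists 0%N; apply: nonneg_on_sub (stage_le _ _ _) d.
exact/ltW/stage_gt0.
Qed.

Lemma eventually_absurd s n a : a < 0 -> ~ eventually_nonneg s n (a *: e n).
Proof.
by move=> a0 [i]; apply: nonneg_on_absurd (stage_gt0 _ _ _) (stage_le _ _ _) a0.
Qed.

(** r is the limit of the element x, measured in units of e n, along s. *)
Definition limit_value s n x r :=
  (forall l, l < r -> eventually_nonneg s n (x - l *: e n)) /\
  (forall l, r < l -> eventually_nonneg s n (l *: e n - x)).

Lemma limit_value_uniq s n x r t : descending s ->
  limit_value s n x r -> limit_value s n x t -> r = t.
Proof.
move=> ds; wlog rt : r t / r < t => [wl|].
  by move=> xr xt; have [rt|tr|//] := ltgtP r t; [exact: wl|exact/esym/wl].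
move=> [_ xr] [xt _]; exfalso.
have [l [rl lt]] : exists l, r < l /\ l < t.
  by exists ((r + t) / 2%:R); rewrite midf_lt//; have [] := midf_lt rt.
have [m [lm mt]] : exists m, l < m /\ m < t.
  by exists ((l + t) / 2%:R); rewrite midf_lt//; have [] := midf_lt lt.
have := eventuallyD ds (xr _ rl) (xt _ mt).
have -> : l *: e n - x + (x - m *: e n) = (l - m) *: e n.
  by rewrite scalerBl addrA subrK.
by apply: eventually_absurd; rewrite subr_lt0.
Qed.

Lemma limit_valueD s n x y r t : descending s ->
  limit_value s n x r -> limit_value s n y t -> limit_value s n (x + y) (r + t).
Proof.
move=> ds [xl xr] [yl yr]; split=> l hl.
  have -> : x + y - l *: e n =
      x - (r - (r + t - l) / 2) *: e n + (y - (t - (r + t - l) / 2) *: e n).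
    rewrite addrACA -opprD -scalerDl; congr (_ - _ *: _).
    by rewrite addrACA -opprD -splitr; ring.
  have h : 0 < (r + t - l) / 2 by rewrite divr_gt0 ?subr_gt0.
  by apply: eventuallyD => //; [apply: xl|apply: yl]; rewrite ltrBlDr ltrDl.
have -> : l *: e n - (x + y) =
    (r + (l - (r + t)) / 2) *: e n - x + ((t + (l - (r + t)) / 2) *: e n - y).
  rewrite addrACA -opprD -scalerDl; congr (_ *: _ - _).
  by rewrite addrACA -splitr; ring.
have h : 0 < (l - (r + t)) / 2 by rewrite divr_gt0 ?subr_gt0.
by apply: eventuallyD => //; [apply: xr|apply: yr]; rewrite ltrDl.
Qed.

Lemma limit_valueN s n x r : limit_value s n x r -> limit_value s n (- x) (- r).
Proof.
move=> [xl xr]; split=> l hl.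
  have -> : - x - l *: e n = (- l) *: e n - x by rewrite scaleNr addrC.
  by apply: xr; rewrite ltrNr.
have -> : l *: e n - - x = x - (- l) *: e n by rewrite scaleNr !opprK addrC.
by apply: xl; rewrite ltrNl.
Qed.

Lemma limit_value_disj s n x : disj x (e n) -> limit_value s n x 0.
Proof.
move=> d; have x0 := disj_ge0l d; have e0 := ltW (e_gt0 n); split=> l l0.
  apply: eventually_ge0; rewrite -scaleNr vaddr_ge0// vscale_ge0//.
  by rewrite oppr_ge0 ltW.
apply: eventually_disj; apply: disj_le d; first exact: vpos_ge0.
by rewrite vpos_le x0 andbT opprB vle_sub// vscale_ge0// ltW.
Qed.

Lemma limit_valueZ s n a x r : 0 < a ->
  limit_value s n x r -> limit_value s n (a *: x) (a * r).
Proof.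
move=> a0 [xl xr]; have aK l : l = a * (l / a) by rewrite mulrC divfK ?gt_eqF.
split=> l hl; rewrite [l]aK -scalerA -scalerBr; apply: eventuallyZ (ltW a0) _.
  by apply: xl; rewrite ltr_pdivrMr// mulrC.
by apply: xr; rewrite ltr_pdivlMr// mulrC.
Qed.

Lemma limit_value_linear s n a x y r t : descending s ->
  limit_value s n x r -> limit_value s n y t ->
  limit_value s n (a *: x + y) (a * r + t).
Proof.
move=> ds xr yt; apply: limit_valueD => //.
have [a0|a0|->] := ltgtP a 0; last 1 first.
- by rewrite scale0r mul0r; apply: limit_value_disj; exact/disj0/ltW.
- rewrite -[a]opprK scaleNr mulNr; apply: limit_valueN.
  by apply: limit_valueZ => //; rewrite oppr_gt0.
- exact: limit_valueZ.
Qed.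

Lemma limit_value_join s n x y r t : descending s ->
  limit_value s n x r -> limit_value s n y t ->
  limit_value s n (vjoin x y) (Num.max r t).
Proof.
move=> ds [xl xr] [yl yr]; split=> l.
  rewrite lt_max => /orP[/xl|/yl]; apply: eventually_mono; apply: vleD2r;
  by rewrite ?vjoinl ?vjoinr.
rewrite gt_max => /andP[/xr/(eventually_at ds)[i xi] /yr/(eventually_at ds)[j yj]].
exists (maxn i j).
apply: disj_le (disjD (xi _ (leq_maxl _ _)) (yj _ (leq_maxr _ _))).
  exact: vpos_ge0.
rewrite !opprB vpos_le vaddr_ge0 ?vpos_ge0// andbT vlerBlDr vjoin_le.
apply/andP; split; rewrite -vlerBlDr; apply: le_trans (vpos_ge _) _.
  by rewrite vle_addr ?vpos_ge0.
by rewrite vle_addl ?vpos_ge0.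
Qed.

Lemma limit_value_unit s n : limit_value s n (e n) 1.
Proof.
have e0 := ltW (e_gt0 n); split=> l hl; apply: eventually_ge0.
  by rewrite -{1}[e n]scale1r -scalerBl vscale_ge0// subr_ge0 ltW.
by rewrite -{2}[e n]scale1r -scalerBl vscale_ge0// subr_ge0 ltW.
Qed.

Lemma dense_at n (Q : set E) :
  (forall p, 0 < p -> p <= e n -> exists2 q, 0 < q <= p & Q q) ->
  dense refines [set P : condition | Q (sval P n)].
Proof.
move=> hQ [f hf]; have /andP[fn0 fne] := hf n.
have [q /andP[q0 qf] Qq] := hQ _ fn0 fne.
have hg k : 0 < (if k == n then q else f k) <= e k.
  by case: eqP => [->|_]; [rewrite q0 (le_trans qf)|exact: hf].
exists (exist _ _ hg) => [k|] /=; last by rewrite eqxx.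
by case: eqP => [->|].
Qed.

Lemma full_eventually_nonneg n z :
  character_filter [set s | eventually_nonneg s n z \/ eventually_nonneg s n (- z)].
Proof.
have := @dense_at n [set q | nonneg_on q z \/ nonneg_on q (- z)].
move=> /(_ (fun _ h _ => sign_dichotomy z h))/(generic_dense top_condition refines_refl).
by apply: full_imp => s [i [zi|zi]]; [left|right]; exists i.
Qed.

Lemma full_eventually_bounded n z :
  character_filter
    [set s | exists k : nat, eventually_nonneg s n (k%:R *: e n - z)].
Proof.
have dQ : dense refines [set P : condition |
    exists k : nat, nonneg_on (sval P n) (k%:R *: e n - z)].
  apply: (@dense_at n [set q | exists k : nat, nonneg_on q (k%:R *: e n - z)]).
  by move=> p p0 /(locally_bounded z p0)[k [q qp qz]]; exists q => //; exists k.
apply: full_imp (generic_dense top_condition refines_refl dQ).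
by move=> s [i [k ki]]; exists k, i.
Qed.

Lemma full_descending : character_filter descending.
Proof. exact: generic_desc. Qed.

(** Comparing x with the rational multiples of e n determines a cut, which is
    bounded because x is locally bounded on both sides. *)
Lemma full_limit_value n x :
  character_filter [set s | exists r, limit_value s n x r].
Proof.
have dich := full_countable (fun q : rat => full_eventually_nonneg n (x - ratr q *: e n)).
have bnd := fullI (full_eventually_bounded n x) (full_eventually_bounded n (- x)).
apply: full_imp (fullI full_descending (fullI dich bnd)).
move=> s [ds [/= dich_s [[k ub] [k' lb]]]].
pose L := [set l : R | eventually_nonneg s n (x - l *: e n)].
have Lle l m : l <= m -> L m -> L l.
  move=> lm; apply: eventually_mono; apply: vleD2l; rewrite vleN2 -vsub_ge0 -scalerBl.
  by rewrite vscale_ge0 ?subr_ge0// ltW.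
have Lub : ubound L k%:R.
  move=> l Ll; rewrite leNgt; apply/negP => kl.
  have := eventuallyD ds ub Ll; rewrite addrA subrK -scalerBl.
  by apply: eventually_absurd; rewrite subr_lt0.
have L0 : L !=set0.
  exists (- k'%:R); apply: eventually_mono lb.
  by rewrite opprK scaleNr opprK addrC.
have hs : has_sup L by split=> //; exists k%:R.
exists (sup L); split=> l hl.
  have [m Lm lm] := sup_adherent (eps := sup L - l) ltac:(by rewrite subr_gt0) hs.
  by apply: Lle Lm; rewrite opprB addrC subrK in lm; exact: ltW.
have [q] := rat_in_itvoo hl; rewrite in_itv/= => /andP[Lq ql].
case: (dich_s q) => [Lq'|].
  by have := ub_le_sup (proj2 hs) Lq'; rewrite leNgt Lq.
rewrite opprB; apply: eventually_mono; apply: vleD2r.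
by rewrite -vsub_ge0 -scalerBl vscale_ge0 ?subr_ge0// ltW.
Qed.

Definition character n s x : R := xget 0 [set r | limit_value s n x r].

Lemma full_character n x :
  character_filter [set s | descending s /\ limit_value s n x (character n s x)].
Proof.
apply: full_imp (fullI full_descending (full_limit_value n x)) => s [ds [r xr]].
by split=> //; rewrite /character; case: xgetP => // /(_ r).
Qed.

Lemma character_linear n a x y : character_filter
  [set s | character n s (a *: x + y) = a * character n s x + character n s y].
Proof.
have := fullI (full_character n (a *: x + y))
  (fullI (full_character n x) (full_character n y)).
apply: full_imp => s [[ds h] [[_ hx] [_ hy]]].
exact: limit_value_uniq h (limit_value_linear _ _ hx hy).
Qed.

Lemma character_join n x y : character_filter
  [set s | character n s (vjoin x y) = Num.max (character n s x) (character n s y)].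
Proof.
have := fullI (full_character n (vjoin x y))
  (fullI (full_character n x) (full_character n y)).
apply: full_imp => s [[ds h] [[_ hx] [_ hy]]].
exact: limit_value_uniq h (limit_value_join _ hx hy).
Qed.

Lemma character_unit n : character_filter [set s | character n s (e n) = 1].
Proof.
apply: full_imp (full_character n (e n)) => s [ds h].
exact: limit_value_uniq h (limit_value_unit _ _).
Qed.

Lemma character_disj n x : disj x (e n) ->
  character_filter [set s | character n s x = 0].
Proof.
move=> d; apply: full_imp (full_character n x) => s [ds h].
exact: limit_value_uniq h (limit_value_disj _ d).
Qed.

End GenericCharacters.

(** * Lattice expressions have no Cauchy matrix among their values *)

Lemma pigeonhole_fiber (T U : finType) (f : T -> U) N : (#|U| * N < #|T|)%N ->
  exists u, (N < #|[set t | f t == u]%SET|)%N.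
Proof.
move=> UT; apply/existsP; apply: contraLR UT => /existsPn h; rewrite -leqNgt.
rewrite -sum1_card (partition_big f predT)//= -sum_nat_const leq_sum// => u _.
by have := h u; rewrite -leqNgt cardsE; rewrite -sum1_card.
Qed.

Lemma injection_in_set (T : finType) (A : {set T}) N : (N <= #|A|)%N ->
  exists2 g : 'I_N -> T, injective g & forall i, g i \in A.
Proof.
move=> NA; exists (fun i => enum_val (widen_ord NA i)) => [i j|i].
  by move=> /enum_val_inj/(congr1 val)/= ij; exact: val_inj.
exact: enum_valP.
Qed.

(** Among many columns, enough of them carry the same colours on the first
    rows, and among these rows enough have the same colour. *)
Lemma monochromatic_grid (C : finType) (t : nat -> nat -> C) N :
  exists (r c : 'I_N -> nat) (k : C),
    [/\ injective r, injective c & forall i j, t (r i) (c j) = k].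
Proof.
pose M1 := (#|C| * N).+1.
pose M2 := (#|{ffun 'I_M1 -> C}| * N).+1.
pose f (m : 'I_M2) : {ffun 'I_M1 -> C} := [ffun n : 'I_M1 => t n m].
have [|g /ltnW/injection_in_set[c cI cg]] := @pigeonhole_fiber _ _ f N.
  by rewrite card_ord.
have [|k /ltnW/injection_in_set[r rI rk]] := @pigeonhole_fiber _ _ g N.
  by rewrite card_ord.
exists (fun i => r i : nat), (fun i => c i : nat), k; split=> [i j|i j|i j].
- by move=> /val_inj/rI.
- by move=> /val_inj/cI.
- have := cg j; rewrite inE => /eqP gE.
  by have := rk i; rewrite inE -gE ffunE => /eqP.
Qed.

(** A row vector killing the matrix would be the vector of coefficients, in
    the Lagrange basis attached to the poles, of a polynomial with more roots
    than its degree allows. *)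
Lemma cauchy_matrix_rank (R : realFieldType) (N K : nat) (r c : 'I_N -> nat)
    (A : 'M[R]_(N, K)) (B : 'M[R]_(K, N)) :
  (K < N)%N -> injective r -> injective c ->
  ~ forall i j, (A *m B) i j = ((r i + c j).+1%:R)^-1.
Proof.
move=> KN rI cI AB.
have : kermx A != 0.
  by rewrite -mxrank_eq0 mxrank_ker -lt0n subn_gt0 (leq_ltn_trans (rank_leq_col _)).
move=> /rowV0Pn[v /sub_kermxP vA v0].
(* P vanishes at the c j because v kills the matrix, so P = 0; evaluating P at
   the pole - (r i + 1) isolates the i-th coefficient. *)
pose p i : {poly R} := \prod_(k < N | k != i) ('X - (- (r k).+1%:R)%:P).
pose P := \sum_(i < N) v 0 i *: p i.
have pE i x : (p i).[x] = \prod_(k < N | k != i) (x + (r k).+1%:R).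
  by rewrite horner_prod; apply: eq_bigr => k _; rewrite !hornerE opprK.
have PE x : P.[x] = \sum_(i < N) v 0 i * \prod_(k < N | k != i) (x + (r k).+1%:R).
  by rewrite /P horner_sum; apply: eq_bigr => i _; rewrite hornerZ pE.
have size_P : (size P <= N)%N.
  apply: (leq_trans (size_sum _ _ _)); apply/bigmax_leqP => i _.
  apply: (leq_trans (size_scale_leq _ _)); rewrite size_prod => [|k _].
    under eq_bigr => k _ do rewrite size_XsubC.
    rewrite sum_nat_const muln2 -addnn subSn ?leq_addr// addnK.
    by rewrite (cardC1 i) card_ord prednK// (leq_ltn_trans _ KN).
  by rewrite polyXsubC_eq0.
have root_P j : root P (c j)%:R.
  have : ((v *m A) *m B) 0 j = 0 by rewrite vA mul0mx mxE.
  rewrite -mulmxA mxE => /(congr1 (fun x => (\prod_(k < N) (r k + c j).+1%:R) * x)).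
  rewrite mulr0 mulr_sumr => vj; apply/rootP; rewrite PE -[RHS]vj.
  apply: eq_bigr => i _; rewrite AB mulrCA; congr (_ * _).
  rewrite [X in _ = X * _](bigD1 i)//= mulrC mulKf ?pnatr_eq0//.
  by apply: eq_bigr => k _; rewrite -natrD addnS addnC.
have P0 : P = 0.
  apply: (@roots_geq_poly_eq0 _ _ [seq (c j)%:R | j <- enum 'I_N]).
  - by apply/allP => _ /mapP[j _ ->].
  - rewrite map_inj_uniq ?enum_uniq// => j k /eqP; rewrite eqr_nat => /eqP; exact: cI.
  - by rewrite size_map size_enum_ord.
case/negP: v0; apply/eqP/rowP => i; rewrite mxE.
have := PE (- (r i).+1%:R); rewrite P0 horner0 (bigD1 i)//= [X in _ + X]big1 => [|k ki].
  rewrite addr0 => /esym/eqP; rewrite mulf_eq0 => /orP[/eqP//|].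
  rewrite prodf_seq_eq0 => /hasP[k _ /andP[ki]].
  by rewrite addrC subr_eq0 eqr_nat eqSS => /eqP/rI ki'; rewrite ki' eqxx in ki.
by rewrite (bigD1 i) 1?eq_sym//= addNr mul0r mulr0.
Qed.

Section Pieces.
Variables (R : realType) (E F : archRieszType R).

Definition piece := seq (R * (E * F)).

(** The linear expressions among which the value of a lattice expression is
    always found, whatever the values given to its generators. *)
Fixpoint pieces (s : texpr E F) : seq piece :=
  match s with
  | TGen x y => [:: [:: (1, (x, y))]]
  | TZero => [:: [::]]
  | TAdd s1 s2 => [seq l1 ++ l2 | l1 <- pieces s1, l2 <- pieces s2]
  | TScale a s1 => [seq [seq (a * t.1, t.2) | t <- l] | l <- pieces s1]
  | TJoin s1 s2 => pieces s1 ++ pieces s2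
  end.

Definition piece_value (psi : E -> F -> R) (l : piece) : R :=
  \sum_(t <- l) t.1 * psi t.2.1 t.2.2.

Lemma teval_piece (psi : E -> F -> R^o) (s : texpr E F) :
  exists2 l, l \in pieces s & teval psi s = piece_value psi l.
Proof.
elim: s => [x y||s1 IH1 s2 IH2|a s [l ls e]|s1 IH1 s2 IH2] /=.
- by exists [:: (1, (x, y))]; rewrite ?mem_head// /piece_value big_seq1 mul1r.
- by exists [::]; rewrite ?mem_head// /piece_value big_nil.
- have [[l1 l1s e1] [l2 l2s e2]] := (IH1, IH2).
  exists (l1 ++ l2); first exact: allpairs_f.
  by rewrite e1 e2 /piece_value big_cat.
- exists [seq (a * t.1, t.2) | t <- l]; first exact: map_f.
  rewrite e /piece_value big_map /= [LHS]mulr_sumr.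
  by apply: eq_bigr => t _; rewrite mulrA.
- have [[l1 l1s e1] [l2 l2s e2]] := (IH1, IH2).
  have [le12|le21] := leP (teval psi s1 : R) (teval psi s2).
    exists l2; first by rewrite mem_cat l2s orbT.
    by rewrite -e2; apply: vjoin_r.
  exists l1; first by rewrite mem_cat l1s.
  by rewrite -e1; apply: vjoin_l; exact: ltW.
Qed.

(** One linear piece, with size l terms, would factor a submatrix of size
    larger than size l through a space of dimension size l. *)
Lemma teval_not_cauchy (chi : nat -> E -> R) (xi : nat -> F -> R) (s : texpr E F) :
  ~ forall n m : nat,
    teval (fun x y => chi n x * xi m y : R^o) s = ((n + m).+1%:R)^-1.
Proof.
move=> sE.
have [t ts tE] := all_sig2 (fun nm : nat * nat =>
  cid2 (teval_piece (fun x y => chi nm.1 x * xi nm.2 y) s)).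
pose K := \max_(l <- pieces s) size l.
have [r [c [k [rI cI kE]]]] :=
  monochromatic_grid (fun n m => SeqSub (ts (n, m))) K.+1.
pose l := ssval k.
pose d : R * (E * F) := (0, (0, 0)).
pose A : 'M[R]_(K.+1, size l) :=
  \matrix_(i, j) ((nth d l j).1 * chi (r i) (nth d l j).2.1).
pose B : 'M[R]_(size l, K.+1) := \matrix_(j, i) xi (c i) (nth d l j).2.2.
have lK : (size l < K.+1)%N.
  by rewrite ltnS; apply: leq_bigmax_seq => //; exact: ssvalP.
apply: (@cauchy_matrix_rank R _ _ r c A B lK rI cI) => i j.
rewrite -sE (tE (r i, c j)) (_ : t (r i, c j) = l); last first.
  by rewrite /l -(kE i j).
rewrite /piece_value (big_nth d) big_mkord mxE.
by apply: eq_bigr => q _; rewrite !mxE mulrA.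
Qed.

End Pieces.

(** * The Cauchy family has no supremum *)

Section CharacterFacts.
Variables (R : realType) (E : archRieszType R) (e : nat -> E).
Hypothesis e_gt0 : forall n, 0 < e n.
Let U := character_filter e_gt0.

Lemma character_ge0 n x : 0 <= x -> U [set s | 0 <= character n s x].
Proof.
move=> x0; have := fullI (character_join e_gt0 n x 0)
  (character_disj e_gt0 (disj0 (ltW (e_gt0 n)))).
apply: full_imp => s [/=]; rewrite vjoin_l// => -> ->.
by rewrite le_max lexx orbT.
Qed.

Lemma character_component n x : disj (e n) (x - e n) ->
  U [set s | character n s x = 1].
Proof.
move=> /disj_sym d; have := fullI (character_linear e_gt0 n 1 (x - e n) (e n))
  (fullI (character_disj e_gt0 d) (character_unit e_gt0 n)).
apply: full_imp => s [/= h [/= h0 h1]].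
by rewrite scale1r subrK h0 h1 mulr0 add0r in h.
Qed.

End CharacterFacts.

Section CauchyFamily.
Variables (R : realType) (E F : archRieszType R).
Variables (e : nat -> E) (f : nat -> F).
Hypotheses (e_gt0 : forall n, 0 < e n) (f_gt0 : forall n, 0 < f n).

Let U := character_filter e_gt0.
Let V := character_filter f_gt0.
Let X := ((nat -> condition e) * (nat -> condition f))%type.

Definition char_product n m (w : X) (x : E) (y : F) : R^o :=
  character n w.1 x * character m w.2 y.

Definition germ_product n m (x : E) (y : F) : reduced_power R (fubini U V) :=
  germ _ (fun w : X => char_product n m w x y).

Lemma germ_product_bimorphism n m : riesz_bimorphism (germ_product n m).
Proof.
have linl y : linear (germ_product n m ^~ y).
  move=> a x x'; rewrite germZ germD; apply/germP.
  apply: full_imp (fubinil V (character_linear e_gt0 n a x x')) => w /= h.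
  by rewrite /char_product h mulrDl mulrA.
have linr x : linear (germ_product n m x).
  move=> a y y'; rewrite germZ germD; apply/germP.
  apply: full_imp (fubinir U (character_linear f_gt0 m a y y')) => w /= h.
  by rewrite /char_product h mulrDr mulrCA.
split=> // [y y0|x x0]; apply: join_riesz_hom => // z z'.
  rewrite germ_join; apply/germP.
  apply: full_imp (fullI (fubinil V (character_join e_gt0 n z z'))
                         (fubinir U (character_ge0 f_gt0 m y0))) => w [/= h h'].
  by rewrite /char_product h maxr_pMl.
rewrite germ_join; apply/germP.
apply: full_imp (fullI (fubinir U (character_join f_gt0 m z z'))
                       (fubinil V (character_ge0 e_gt0 n x0))) => w [/= h h'].
by rewrite /char_product h maxr_pMr.
Qed.

Lemma teval_germ n m (s : texpr E F) :
  teval (germ_product n m) s = germ _ (fun w : X => teval (char_product n m w) s).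
Proof.
elim: s => [x y||s1 IH1 s2 IH2|a s IH|s1 IH1 s2 IH2] //=.
- by rewrite IH1 IH2 germD.
- by rewrite IH germZ.
- by rewrite IH1 IH2 germ_join.
Qed.

Variables (x : E) (y : F).
Hypotheses (e_disj : forall n m, n != m -> disj (e n) (e m)).
Hypotheses (f_disj : forall n m, n != m -> disj (f n) (f m)).
Hypotheses (e_comp : forall n, disj (e n) (x - e n)).
Hypotheses (f_comp : forall n, disj (f n) (y - f n)).

Let c n m : R := (n + m).+1%:R^-1.

Definition cauchy_family : set (E ⊗ F) :=
  range (fun nm : nat * nat => c nm.1 nm.2 *: tensor (e nm.1) (f nm.2)).


Let tensorDl a b z : tensor (a + b) z = tensor a z + tensor b z :> E ⊗ F.
Proof. by case: (tensor_bimorphism E F) => /(_ z)/linD. Qed.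

Let tensorDr z a b : tensor z (a + b) = tensor z a + tensor z b :> E ⊗ F.
Proof. by case: (tensor_bimorphism E F) => _ /(_ z)/linD. Qed.

Let tensor_le2 a a' b b' : 0 <= a -> a <= a' -> 0 <= b -> b <= b' ->
  tensor a b <= tensor a' b' :> E ⊗ F.
Proof.
move=> a0 aa' b0 bb'; have [_ _ hl hr] := tensor_bimorphism E F.
exact: le_trans (riesz_hom_le (hl b b0) aa') (riesz_hom_le (hr a' (le_trans a0 aa')) bb').
Qed.

Let e0 n : 0 <= e n. Proof. exact: ltW. Qed.
Let f0 n : 0 <= f n. Proof. exact: ltW. Qed.
Let ex n : e n <= x. Proof. by rewrite -vsub_ge0; exact: disj_ge0r (e_comp n). Qed.
Let fy n : f n <= y. Proof. by rewrite -vsub_ge0; exact: disj_ge0r (f_comp n). Qed.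
Let x0 : 0 <= x. Proof. exact: le_trans (e0 0%N) (ex 0%N). Qed.
Let y0 : 0 <= y. Proof. exact: le_trans (f0 0%N) (fy 0%N). Qed.
Let c0 n m : 0 <= c n m. Proof. by rewrite invr_ge0. Qed.
Let c1 n m : c n m <= 1. Proof. by rewrite invf_le1 ?ler1n. Qed.

Let gen_ge0 n m : 0 <= tensor (e n) (f m) :> E ⊗ F.
Proof.
have [_ _ hl _] := tensor_bimorphism E F.
exact: riesz_hom_ge0 (hl (f m) (f0 m)) (e0 n).
Qed.

Let genZ_le n m : c n m *: tensor (e n) (f m) <= tensor (e n) (f m) :> E ⊗ F.
Proof.
rewrite -vsub_ge0 -{1}[tensor _ _]scale1r -scalerBl.
by apply: vscale_ge0 (gen_ge0 n m); rewrite subr_ge0 c1.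
Qed.

Lemma cauchy_family_bounded : has_ubound cauchy_family.
Proof.
exists (tensor x y) => _ [[n m] _ <-] /=.
by apply: le_trans (genZ_le _ _) _; exact: tensor_le2.
Qed.

(** Since e n and f m are components, the other members of the family lie below
    x ⊗ y - e n ⊗ f m. Hence a supremum cannot exceed the prescribed coefficient
    on the block (n, m), where this difference vanishes. *)
Lemma cauchy_family_ubound n m : ubound cauchy_family
  (c n m *: tensor (e n) (f m) + (tensor x y - tensor (e n) (f m))).
Proof.
move=> _ [[i j] _ <-] /=.
have [[-> ->]|ne] := pselect (i = n /\ j = m).
  by apply: vle_addr; rewrite vsub_ge0; exact: tensor_le2.
apply: le_trans (genZ_le _ _) _; apply: (@le_trans _ _ (tensor x y - tensor (e n) (f m))).
  rewrite vlerBrDr; have [ein|jm] : i != n \/ j != m.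
  - by have [ei|] := eqVneq i n; [right; apply: contra_notN ne => /eqP jm|left].
  - apply: (@le_trans _ _ (tensor (e i + e n) y)).
      by rewrite tensorDl; apply: vleD; exact: tensor_le2.
    apply: tensor_le2 => //; first exact: vaddr_ge0.
    by apply: disj_addr_le => //; exact: e_disj.
  - apply: (@le_trans _ _ (tensor x (f j + f m))).
      by rewrite tensorDr; apply: vleD; exact: tensor_le2.
    apply: tensor_le2 => //; first exact: vaddr_ge0.
    by apply: disj_addr_le => //; exact: f_disj.
by apply: vle_addl; exact: vscale_ge0 (c0 n m) (gen_ge0 n m).
Qed.

Lemma cauchy_family_no_supremum : ~ (supremums cauchy_family !=set0).
Proof.
move=> [h [hub hmin]].
have value n m : fubini U V
    [set w : X | teval (char_product n m w) (repr h) = c n m].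
  have bim := germ_product_bimorphism n m.
  have hom := tensor_lift_hom bim; have [homL _ _] := hom.
  have hE : tensor_lift (germ_product n m) h =
    germ _ (fun w : X => teval (char_product n m w) (repr h)) by exact: teval_germ.
  have lb : c n m *: tensor (e n) (f m) <= h by apply: hub; exists (n, m).
  have ub : h <= c n m *: tensor (e n) (f m) + (tensor x y - tensor (e n) (f m)).
    by apply: hmin; exact: cauchy_family_ubound.
  have {}lb := riesz_hom_le hom lb; have {}ub := riesz_hom_le hom ub.
  rewrite (linD homL) (linB homL) in ub.
  rewrite (linZ homL) hE !tensor_lift_gen// in lb, ub.
  rewrite germZ in lb, ub.
  have {}ub : germ (fubini U V) (fun w : X => teval (char_product n m w) (repr h)) +
      germ_product n m (e n) (f m) <=
      germ _ (fun w : X => c n m * char_product n m w (e n) (f m)) + germ_product n m x y.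
    by rewrite -vlerBrDr -addrA.
  rewrite !germD in ub.
  move: lb ub => /le_germ lb /le_germ ub.
  have un := fullI (fubinil V (character_unit e_gt0 n))
                   (fubinir U (character_unit f_gt0 m)).
  have uc := fullI (fubinil V (character_component e_gt0 (e_comp n)))
                   (fubinir U (character_component f_gt0 (f_comp m))).
  have := fullI (fullI un uc) (fullI lb ub); apply: full_imp => w.
  rewrite /= /char_product => -[[[-> ->] [-> ->]]] [].
  rewrite !mulr1 lerD2r => l1 l2.
  by apply: le_anti; rewrite l1 l2.
(* One point at which all the countably many values are exact. *)
have [w hw] := full_nonempty (full_countable (fun nm => value nm.1 nm.2)).
apply: (@teval_not_cauchy R E F (fun n => character n w.1)
  (fun m => character m w.2) (repr h)) => n m.
exact: hw (n, m).
Qed.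

End CauchyFamily.

Lemma not_tensor_complete (R : realType) (A : Type) (E F : archRieszType R)
    (x : E) (e : nat -> E) (y : F) (f : nat -> F) :
    infinite_set [set: A] ->
    (forall n, 0 < e n) -> (forall n, 0 < f n) ->
    (forall n m, n != m -> disj (e n) (e m)) ->
    (forall n m, n != m -> disj (f n) (f m)) ->
    (forall n, disj (e n) (x - e n)) -> (forall n, disj (f n) (y - f n)) ->
  ~ dedekind_complete A (E ⊗ F).
Proof.
move=> /infiniteP A_inf e0 f0 ed fd ec fc cpl.
apply: (cauchy_family_no_supremum e0 f0 ed fd ec fc); apply: cpl.
- by eexists; exists (0%N, 0%N).
- exact: cauchy_family_bounded.
- apply: card_le_trans A_inf; apply: card_le_trans (card_image_le _ _) _.
  exact: countableP.
Qed.

(** * Finitely supported families as direct sums *)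

Section RegularDisjoint.
Variables (R : realType) (E : rieszType R).

Lemma regular_disj (a b : R^o) : disj a b ->
  [/\ 0 <= (a : R), 0 <= (b : R) & a = 0 \/ b = 0].
Proof.
move=> d; split; [exact: (disj_ge0l d)|exact: (disj_ge0r d)|].
have : Num.min (a : R) b = 0 := d.
by case: leP => [_|_] ->; [left|right].
Qed.

Lemma regular_disj_scale (a b : R^o) (y z : E) : 0 <= y -> 0 <= z ->
  disj a b -> disj ((a : R) *: y) ((b : R) *: z).
Proof.
move=> y0 z0 /regular_disj[a0 b0 [->|->]]; rewrite scale0r.
  by apply: disj0; exact: vscale_ge0.
by apply/disj_sym/disj0; exact: vscale_ge0.
Qed.

End RegularDisjoint.

Lemma infinite_injection (T : Type) (A : set T) : infinite_set A ->
  exists2 f : nat -> T, injective f & forall n, A (f n).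
Proof.
move=> /infiniteP/card_leP[f].
exists (fun n => val (f (SigSub (mem_set I : n \in [set: nat])))).
  move=> n m /val_inj/(@inj _ _ _ f) => /(_ (mem_setT _) (mem_setT _)).
  by move=> /(congr1 val).
by move=> n; exact/set_mem/valP.
Qed.

Section DirectSum.
Variables (R : realType) (I : choiceType) (G : archRieszType R).
Implicit Types (g h : c00 I G) (i j : I) (y : G).

Definition c00_supp g : set I := [set i | g i != 0].

Lemma c00_supp_finite g : finite_set (c00_supp g).
Proof. by apply/asboolP; exact: (valP g). Qed.

Lemma c00_support2 g h : exists r : seq I,
  [/\ uniq r, forall i, g i != 0 -> i \in r & forall i, h i != 0 -> i \in r].
Proof.
have fgh : finite_set (c00_supp g `|` c00_supp h).
  by rewrite finite_setU; split; exact: c00_supp_finite.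
have [r rE] := iffLR (finite_seqP _) fgh; exists (undup r).
have mem i : (c00_supp g `|` c00_supp h) i -> i \in undup r.
  by rewrite rE mem_undup.
by split=> [|i gi|i hi]; [exact: undup_uniq|apply: mem; left|apply: mem; right].
Qed.

Lemma c00D g h i : (g + h) i = g i + h i. Proof. by []. Qed.
Lemma c00Z a g i : (a *: g) i = a *: g i. Proof. by []. Qed.
Lemma c00_disj g h i : disj g h -> disj (g i) (h i).
Proof. by move=> d; rewrite /disj -[vmeet _ _]/((vmeet g h) i) d. Qed.

Lemma disj_c00 g h : (forall i, disj (g i) (h i)) -> disj g h.
Proof. by move=> d; apply/val_inj/funext => i; exact: d. Qed.

Fact in_c00_delta i y : (fun j => if j == i then y else 0) \in @in_c00 R I G.
Proof.
apply/asboolP; apply: (@sub_finite_set _ _ [set i]); last exact: finite_set1.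
by move=> j /=; have [->//|] := eqVneq j i; rewrite eqxx.
Qed.

Definition c00_delta i y : c00 I G := C00 (in_c00_delta i y).

Lemma c00_delta_eval i y j : c00_delta i y j = if j == i then y else 0.
Proof. by []. Qed.

Lemma c00_deltaZ a i y : a *: c00_delta i y = c00_delta i (a *: y).
Proof.
apply/val_inj/funext => j; transitivity (a *: (if j == i then y else 0)) => //.
by rewrite -[RHS]/(if j == i then a *: y else 0); case: eqP => // _; rewrite scaler0.
Qed.

Lemma c00_eval_linear j : linear (fun g => g j).
Proof. by []. Qed.

Lemma c00_decomposition g (r : seq I) : uniq r -> (forall i, g i != 0 -> i \in r) ->
  g = \sum_(i <- r) c00_delta i (g i).
Proof.
move=> ur gr; apply/val_inj/funext => j.
rewrite [RHS](lin_sum (c00_eval_linear j)).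
under eq_bigr do rewrite c00_delta_eval.
rewrite -big_mkcond/=; have [jr|jr] := boolP (j \in r).
  rewrite (big_rem j)//= eqxx big1_seq ?addr0// => i /andP[/eqP <-].
  by rewrite mem_rem_uniq// inE eqxx.
rewrite big1_seq => [|i /andP[/eqP <-]]; last by rewrite (negPf jr).
by apply/eqP; apply: contraNT jr => /gr.
Qed.

Variables (H : rieszType R) (T : I -> G -> H).

Definition c00_sum g : H := \sum_(i \in c00_supp g) T i (g i).

Hypothesis T_hom : forall i, riesz_hom (T i).

Lemma c00_sumE g (r : seq I) : uniq r -> (forall i, g i != 0 -> i \in r) ->
  c00_sum g = \sum_(i <- r) T i (g i).
Proof.
move=> ur gr; apply: fsbig_fwiden => // i [_ /= /negP]; rewrite negbK => /eqP ->.
by case: (T_hom i) => L _ _; rewrite (lin0 L).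
Qed.

Lemma c00_sum_linear : linear c00_sum.
Proof.
move=> a g h; have [r [ur gr hr]] := c00_support2 g h.
rewrite (c00_sumE ur gr) (c00_sumE ur hr) (@c00_sumE _ r)// => [|i].
  rewrite scaler_sumr -big_split; apply: eq_bigr => i _ /=.
  by case: (T_hom i) => L _ _; rewrite -L.
rewrite c00D c00Z; have [gi|/gr//] := eqVneq (g i) 0.
by rewrite gi scaler0 add0r => /hr.
Qed.

Lemma c00_sum_delta i y : c00_sum (c00_delta i y) = T i y.
Proof.
rewrite (@c00_sumE _ [:: i])// ?big_seq1 ?c00_delta_eval ?eqxx// => j.
by rewrite c00_delta_eval inE; case: (j == i) => //; rewrite eqxx.
Qed.

Hypothesis T_disj : forall i j y z,
  i != j -> 0 <= y -> 0 <= z -> disj (T i y) (T j z).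

(** The pieces sit in pairwise disjoint parts of the target, so that the sum
    preserves disjointness because each piece does. *)
Lemma c00_sum_hom : riesz_hom c00_sum.
Proof.
apply: disj_riesz_hom => [|g h gh]; first exact: c00_sum_linear.
have [r [ur gr hr]] := c00_support2 g h.
have d i : disj (g i) (h i) by exact: c00_disj.
have g0 i := disj_ge0l (d i); have h0 i := disj_ge0r (d i).
rewrite (c00_sumE ur gr) (c00_sumE ur hr); apply: disj_sum => [|i _].
  by apply: vsumr_ge0 => i _; exact: riesz_hom_ge0.
apply/disj_sym; apply: disj_sum => [|j _]; first exact: riesz_hom_ge0.
by have [->|ji] := eqVneq j i; [apply/disj_sym/riesz_hom_disj|exact: T_disj].
Qed.

End DirectSum.

Section ArchimedeanFacts.
Variables (R : realType) (E : archRieszType R).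
Implicit Types (x y z p q : E) (a b l m : R).

Lemma archimedean_eps p z : (forall a, 0 < a -> z <= a *: p) -> z <= 0.
Proof.
move=> h; apply: (varchimedean z p) => n.
have n0 : (0 : R) < n.+1%:R by [].
have := vleZ (ltW n0) (h (n.+1%:R^-1) _); rewrite invr_gt0 => /(_ n0).
by rewrite scalerA divff ?gt_eqF// scale1r scaler_nat.
Qed.

Lemma vleZl a b x : 0 <= x -> a <= b -> a *: x <= b *: x.
Proof. by move=> x0 ab; rewrite -vsub_ge0 -scalerBl vscale_ge0// subr_ge0. Qed.

Lemma vscaler_le0 a p : 0 < p -> a *: p <= 0 -> a <= 0.
Proof.
move=> p0 ap; rewrite leNgt; apply/negP => a0.
have ai : 0 <= a^-1 by rewrite invr_ge0 ltW.
have := vleZ ai ap; rewrite scalerA mulVf ?gt_eqF// scale1r scaler0.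
by move=> /(lt_le_trans p0); rewrite ltxx.
Qed.

(** The coefficient of p in x, when p is an atom. *)
Lemma max_multiple p x : 0 < p -> 0 <= x ->
  exists l, [/\ 0 <= l, l *: p <= x & forall m, m *: p <= x -> m <= l].
Proof.
move=> p0 x0; pose L := [set m : R | m *: p <= x].
have L0 : L 0 by rewrite /L/= scale0r.
have hs : has_sup L.
  split; first by exists 0.
  apply: contrapT => nb.
  suff : p <= 0 by move=> /(lt_le_trans p0); rewrite ltxx.
  apply: (varchimedean p x) => n; rewrite -scaler_nat.
  apply: contrapT => np; apply: nb; exists n.+1%:R => m Lm.
  rewrite leNgt; apply/negP => /ltW nm; apply: np.
  by apply: le_trans (vleZl (ltW p0) nm) Lm.
exists (sup L); split; first exact: (ub_le_sup (proj2 hs) L0).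
  rewrite -vsub_ge0 -vleN2 opprB oppr0; apply: (archimedean_eps (p := p)) => a a0.
  have [m Lm am] := sup_adherent a0 hs.
  rewrite vlerBlDr; apply: le_trans (_ : (a + m) *: p <= _).
    by apply: vleZl (ltW p0) _; rewrite -lerBlDl ltW.
  by rewrite scalerDl; apply: vleD2l.
by move=> m; exact: (ub_le_sup (proj2 hs)).
Qed.

End ArchimedeanFacts.

(** * Disjoint sequences, components and atoms *)

Section Thin.
Variables (R : realType) (E : archRieszType R).
Implicit Types (x y z p q : E) (u : nat -> E).

Definition disjoint_sequence u x :=
  (forall n, 0 < u n <= x) /\ (forall n m, n != m -> disj (u n) (u m)).

Definition thin x := ~ exists u, disjoint_sequence u x.

Lemma vscale_gt0 (a : R) x : 0 < a -> 0 < x -> 0 < a *: x.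
Proof.
move=> a0 x0; apply: vgt0_neq0; first by rewrite vscale_ge0 ?ltW.
by move=> /eqP; rewrite scaler_eq0 !gt_eqF.
Qed.

Lemma thinZ (a : R) x : 0 < a -> thin x -> thin (a *: x).
Proof.
move=> a0 tx [u [ux ud]]; apply: tx; exists (fun n => a^-1 *: u n).
have ai : 0 < a^-1 by rewrite invr_gt0.
split=> [n|n m nm].
  have /andP[un unx] := ux n; rewrite vscale_gt0//=.
  by have := vleZ (ltW ai) unx; rewrite scalerA mulVf ?gt_eqF// scale1r.
by apply: disjZ (ltW ai) _; apply/disj_sym/disjZ/disj_sym/ud => //; exact: ltW.
Qed.

(** The supremum e n of the x /\ k u n is the component of x carried by u n:
    adding u n /\ (x - e n) to x /\ k u n stays below x /\ (k + 1) u n, so this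
    overlap is zero. *)
Lemma component_sequence (A : Type) x : infinite_set [set: A] ->
  dedekind_complete A E -> ~ thin x -> exists e : nat -> E,
  [/\ forall n, 0 < e n, forall n m, n != m -> disj (e n) (e m)
    & forall n, disj (e n) (x - e n)].
Proof.
move=> /infiniteP A_inf cpl /contrapT[u [ux ud]].
have u0 n : 0 < u n by have /andP[] := ux n.
have ulx n : u n <= x by have /andP[] := ux n.
have x0 : 0 <= x := le_trans (ltW (u0 0%N)) (ulx 0%N).
pose S n : set E := range (fun k : nat => vmeet x (u n *+ k)).
have /(_ _)/cid-/all_sig[e eS] n : supremums (S n) !=set0.
  apply: cpl; first by exists (vmeet x (u n *+ 0)); exists 0%N.
    by exists x => _ [k _ <-]; exact: vmeetl.
  apply: card_le_trans A_inf; exact: card_image_le.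
have S0 n : S n !=set0 by exists (vmeet x (u n *+ 0)), 0%N.
have uk0 n k : 0 <= u n *+ k by rewrite -scaler_nat vscale_ge0// ltW.
have m0 n k : 0 <= vmeet x (u n *+ k) by rewrite le_vmeet x0 uk0.
have ue n : u n <= e n.
  by have [ub _] := eS n; apply: ub; exists 1%N => //; rewrite mulr1n vmeetC vmeet_l.
have ex n : e n <= x.
  by have [_ emin] := eS n; apply: emin => _ [k _ <-]; exact: vmeetl.
have disjMn n k y : disj (u n) y -> disj (vmeet x (u n *+ k)) y.
  move=> d; apply: (disj_le (m0 n k) (vmeetr _ _)).
  by rewrite -scaler_nat; exact: disjZ.
exists e; split=> [n|n m nm|n].
- exact: lt_le_trans (u0 n) (ue n).
- apply: (disj_supremum (S0 n) (eS n)) => _ [k _ <-]; apply: (disjMn).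
  apply/disj_sym/(disj_supremum (S0 m) (eS m)) => _ [l _ <-]; apply: (disjMn).
  by apply: ud; rewrite eq_sym.
apply: (disj_supremum (S0 n) (eS n)) => _ [k _ <-]; apply: (disjMn).
set w := vmeet (u n) (x - e n); rewrite /disj -/w.
have w0 : 0 <= w by rewrite le_vmeet vsub_ge0 ex ltW.
have [eub emin] := eS n; apply: vle_anti w0.
suff : e n <= e n - w.
  by rewrite vlerBrDr -[leRHS]addr0 => /(vleD2l (- e n)); rewrite !addKr.
apply: emin => _ [l _ <-]; rewrite vlerBrDr.
apply: le_trans (eub (vmeet x (u n *+ l.+1)) _); last by exists l.+1.
rewrite le_vmeet mulrSr vleD ?vmeetr ?vmeetl// andbT.
have le_e : vmeet x (u n *+ l) <= e n by apply: eub; exists l.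
by apply: le_trans (vleD le_e (vmeetr _ _)) _; rewrite addrC subrK.
Qed.

Definition atom p := 0 < p /\
  forall q, 0 <= q -> q <= p -> exists l : R, q = l *: p.

(** If l p is the largest multiple of p below q and q is not l p, then for some
    m > l both parts of q - m p are nonzero. *)
Lemma split_nonatom p : 0 < p -> ~ atom p ->
  exists q r, [/\ 0 < q <= p, 0 < r <= p & disj q r].
Proof.
move=> p0 np; apply: contrapT => nsplit; apply: np; split=> // q q0 qp.
have [l [l0 lpq lmax]] := max_multiple p0 q0; exists l.
apply: vle_anti lpq; rewrite -vsub_ge0 -vleN2 opprB oppr0.
apply: (archimedean_eps (p := p)) => a a0; rewrite vlerBlDr -scalerDl.
set m := a + l; have m0 : 0 < m by rewrite ltr_wpDr.
rewrite -vsub_ge0 -vleN2 opprB oppr0; apply: contrapT => nle; apply: nsplit.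
exists (vpos (q - m *: p)), (m^-1 *: vpos (- (q - m *: p))).
have mi : 0 < m^-1 by rewrite invr_gt0.
split.
- rewrite vpos_le (ltW p0) andbT; apply/andP; split.
    apply: vgt0_neq0; first exact: vpos_ge0.
    by move=> h; apply: nle; rewrite -h vpos_ge.
  by apply: le_trans qp; apply: vle_sub; rewrite vscale_ge0// ltW.
- apply/andP; split.
    apply: vscale_gt0 => //; apply: vgt0_neq0; first exact: vpos_ge0.
    move=> h; have : m <= l.
      apply: lmax; rewrite -vsub_ge0 -vleN2 oppr0 -h; exact: vpos_ge.
    by rewrite /m leNgt ltr_pwDl.
  have mK : p = m^-1 *: (m *: p) by rewrite scalerA mulVf ?gt_eqF// scale1r.
  rewrite [leRHS]mK; apply: vleZ (ltW mi) _.
  rewrite vpos_le vscale_ge0 ?(ltW m0) ?(ltW p0)// andbT.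
  by rewrite opprB vle_sub.
- by apply/disj_sym/(disjZ (ltW mi))/disj_sym/vpos_neg_disj.
Qed.

(** Repeatedly splitting a non-atom and keeping one half yields a disjoint
    sequence, so the splitting has to stop at an atom. *)
Lemma atom_below x p : thin x -> 0 < p -> p <= x -> exists2 q, atom q & q <= p.
Proof.
move=> tx p0 px; apply: contrapT => na.
have /(_ _)/cid-/all_sig[g] (q : {q : E | 0 < q <= p}) :
    exists r : {q : E | 0 < q <= p} * {q : E | 0 < q <= p},
      [/\ val r.1 <= val q, val r.2 <= val q & disj (val r.1) (val r.2)].
  case: q => q /= /andP[q0 qp].
  have [|r [s [/andP[r0 rq] /andP[s0 sq] d]]] := split_nonatom q0.
    by move=> aq; apply: na; exists q.
  have rp : 0 < r <= p by rewrite r0 (le_trans rq).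
  have sp : 0 < s <= p by rewrite s0 (le_trans sq).
  by exists (exist _ r rp, exist _ s sp).
move=> gP; have pp : 0 < p <= p by rewrite p0 lexx.
pose s := fix s n : {q : E | 0 < q <= p} :=
  if n is k.+1 then (g (s k)).2 else exist _ p pp.
have s_anti n k : val (s (n + k)%N) <= val (s n).
  elim: k => [|k IH]; first by rewrite addn0 lexx.
  by rewrite addnS; apply: le_trans IH; have [] := gP (s (n + k)%N).
apply: tx; exists (fun n => val (g (s n)).1); split=> [n|].
  by have /andP[-> h] := valP (g (s n)).1; rewrite (le_trans h).
have lt_disj n m : (n < m)%N -> disj (val (g (s n)).1) (val (g (s m)).1).
  move=> nm; have [_ _ d] := gP (s n).
  apply/disj_sym/(disj_le _ _ (disj_sym d)).
    by have /andP[/ltW] := valP (g (s m)).1.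
  have [h _ _] := gP (s m); apply: le_trans h _.
  by rewrite -(subnKC nm); exact: (s_anti n.+1).
by move=> n m; rewrite neq_ltn => /orP[/lt_disj//|/lt_disj/disj_sym].
Qed.

End Thin.

Section DisjointSpan.
Variables (R : realType) (E : archRieszType R) (I : choiceType) (p : I -> E).
Hypotheses (p_gt0 : forall i, 0 < p i).
Hypothesis p_disj : forall i j, i != j -> disj (p i) (p j).

Definition span_map (g : c00 I R^o) : E :=
  c00_sum (fun i (a : R^o) => (a : R) *: p i) g.

Let scale_hom i : riesz_hom (fun a : R^o => (a : R) *: p i).
Proof.
apply: disj_riesz_hom => [a x y|a b]; first by rewrite scalerDl scalerA.
by apply: regular_disj_scale; exact: ltW.
Qed.

Lemma span_map_hom : riesz_hom span_map.
Proof.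
apply: (c00_sum_hom scale_hom) => i j a b ij a0 b0.
by apply: disjZ => //; apply/disj_sym/disjZ => //; exact/disj_sym/p_disj.
Qed.

Lemma span_map_delta i (a : R) : span_map (c00_delta (G := R^o) i a) = a *: p i.
Proof. exact: c00_sum_delta. Qed.

Lemma span_map_coef (g : c00 I R^o) i : 0 <= g -> (g i : R) *: p i <= span_map g.
Proof.
move=> /c00_leP g0; rewrite -span_map_delta; apply: riesz_hom_le span_map_hom _.
apply/c00_leP => j; rewrite c00_delta_eval.
by case: eqP => [->|_]; [exact: lexx|exact: g0].
Qed.

(** The positive part of an element of the kernel has only zero coefficients,
    since each of its terms lies below the image, which is zero. *)
Lemma span_map_inj : injective span_map.
Proof.
have [L J _] := span_map_hom.
have ker g : span_map g = 0 -> g <= 0.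
  move=> g0; have v0 : span_map (vpos g) = 0.
    by rewrite /vpos J (lin0 L) g0 vjoin_r.
  apply/c00_leP => i; have := span_map_coef i (vpos_ge0 g); rewrite v0.
  move=> /(vscaler_le0 (p_gt0 i)) h; apply: le_trans h.
  by have /c00_leP := vpos_ge g; exact.
move=> g h gh; apply: vle_anti; rewrite -vsub_ge0 -vleN2 opprB oppr0.
  by apply: ker; rewrite (linB L) gh subrr.
by apply: ker; rewrite (linB L) gh subrr.
Qed.

End DisjointSpan.

(** * Spaces all of whose elements are thin *)

Section Atomic.
Variables (R : realType) (E : archRieszType R).
Implicit Types (x y z p q : E) (u : nat -> E).

Lemma maximal_disjoint_atoms : exists I : set E,
  [/\ forall a, I a -> atom a,
      forall a b, I a -> I b -> a != b -> disj a b
    & forall p, atom p -> ~ (forall a, I a -> disj a p)].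
Proof.
pose P := [set I : set E | (forall a, I a -> atom a) /\
  forall a b, I a -> I b -> a != b -> disj a b].
have [|I [[Ia Id] Imax]] := @Zorn_bigcup E P.
  move=> F FP Ftot; split=> [a [X FX Xa]|a b [X FX Xa] [Y FY Yb]].
    by have [h _] := FP _ FX; exact: h.
  have [XY|YX] := Ftot _ _ FX FY.
    by have [_ h] := FP _ FY; apply: h => //; exact: XY.
  by have [_ h] := FP _ FX; apply: h => //; exact: YX.
exists I; split=> // p ap Ip.
have pI : ~ I p by move=> /Ip/disjxx p0; have [] := ap; rewrite p0 ltxx.
apply: (Imax (I `|` [set p])).
  by split=> [a Ia'|h]; [left|apply: pI; apply: h; right].
split=> [a [/Ia//|->//]|a b [Ha|->] [Hb|->]] ab; first exact: Id.
- exact: Ip.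
- exact/disj_sym/Ip.
- by rewrite eqxx in ab.
Qed.

Hypothesis E_thin : forall x, 0 <= x -> thin x.

(** Thinness lets only finitely many atoms of I meet x. Subtracting their
    largest multiples leaves an element disjoint from I; were it nonzero, an
    atom below it would contradict the maximality of I. *)
Lemma thin_span (I : set E) :
    (forall a, I a -> atom a) ->
    (forall a b, I a -> I b -> a != b -> disj a b) ->
    (forall p, atom p -> ~ (forall a, I a -> disj a p)) ->
  forall x, 0 <= x -> exists g : c00 I R^o, span_map (fun i : I => val i) g = x.
Proof.
move=> Ia Id Imax x x0.
have i_gt0 (i : I) : 0 < val i by have [] := Ia _ (set_mem (valP i)).
have i_disj (i j : I) : i != j -> disj (val i) (val j).
  by move=> ij; apply: Id; rewrite ?(set_mem (valP _))//; exact/set_mem/valP.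
pose J : set I := [set i : I | ~ disj (val i) x].
have Jfin : finite_set J.
  apply: contrapT => /infinite_injection[f fI fJ]; apply: (E_thin x0).
  exists (fun n => vmeet (val (f n)) x).
  have m0 n : 0 <= vmeet (val (f n)) x by rewrite le_vmeet x0 (ltW (i_gt0 _)).
  split=> [n|n m nm]; first by rewrite vmeetr andbT; apply: vgt0_neq0 => //; exact: fJ.
  apply: (disj_le2 (m0 n) (vmeetl _ _) (m0 m) (vmeetl _ _)).
  by apply: i_disj; apply: contra_neq nm => /fI.
have [r rJ] := iffLR (finite_seqP _) Jfin; pose s := undup r.
have sJ i : ~ disj (val i) x -> i \in s.
  by rewrite mem_undup => ix; have : J i := ix; rewrite rJ.
have /(_ _)/cid-/all_sig[l lP] (i : I) := max_multiple (i_gt0 i) x0.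
exists (\sum_(i <- s) c00_delta (G := R^o) i (l i)).
have [L _ _] := span_map_hom i_gt0 i_disj; rewrite (lin_sum L).
under eq_bigr do rewrite (span_map_delta i_gt0).
set y := \sum_(i <- s) _.
have yx : y <= x.
  apply: disj_sum_le => // [|i j _ _ ij|i _]; first exact: undup_uniq.
    have [l0 _ _] := lP i; have [k0 _ _] := lP j.
    by apply: disjZ => //; apply/disj_sym/disjZ => //; exact/disj_sym/i_disj.
  by have [l0 -> _] := lP i; rewrite andbT vscale_ge0// ltW.
have xy0 : 0 <= x - y by rewrite vsub_ge0.
have y_ge i : i \in s -> l i *: val i <= y.
  move=> si; rewrite /y (big_rem i)//=; apply: vle_addr; apply: vsumr_ge0 => j _.
  by have [l0 _ _] := lP j; exact: vscale_ge0 l0 (ltW (i_gt0 j)).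
have y0 : 0 <= y.
  by apply: vsumr_ge0 => j _; have [l0 _ _] := lP j; rewrite vscale_ge0// ltW.
apply/eqP; rewrite eq_sym -subr_eq0; apply/eqP; apply: contrapT => xy.
have [] := @atom_below _ _ x (x - y); rewrite ?vle_sub//; first exact: E_thin.
  exact: vgt0_neq0.
move=> p ap pxy; apply: (Imax _ ap) => a Iaa.
have [p0 _] := ap; apply/disj_sym/(disj_le (ltW p0) pxy)/disj_sym.
pose i : I := SigSub (mem_set Iaa); rewrite -[a]/(val i).
have [dix|/sJ si] := pselect (disj (val i) x).
  by apply/disj_sym/(disj_le xy0 (vle_sub x y0))/disj_sym.
have w0 : 0 <= vmeet (val i) (x - y) by rewrite le_vmeet xy0 (ltW (i_gt0 i)).
have [_ /(_ _ w0 (vmeetl _ _))[m mE]] := Ia _ Iaa.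
have [_ _ lmax] := lP i.
apply: vle_anti w0; rewrite mE -/(val i).
have : m <= 0.
  rewrite -(lerD2l (l i)) addr0; apply: lmax; rewrite scalerDl.
  apply: (@le_trans _ _ (y + (x - y))); last by rewrite addrC subrK.
  by apply: vleD (y_ge i si) _; rewrite -[val i]/a -mE vmeetr.
move=> /(vleZl (ltW (i_gt0 i))); by rewrite scale0r.
Qed.

Theorem thin_iso_c00 : exists I : set E, E ≅ c00 I R^o.
Proof.
have [I [Ia Id Imax]] := maximal_disjoint_atoms; exists I; apply: riesz_iso_sym.
have i_gt0 (i : I) : 0 < val i by have [] := Ia _ (set_mem (valP i)).
have i_disj (i j : I) : i != j -> disj (val i) (val j).
  by move=> ij; apply: Id; rewrite ?(set_mem (valP _))//; exact/set_mem/valP.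
exists (span_map (fun i : I => val i)); split; first exact: span_map_hom.
have [L _ _] := span_map_hom i_gt0 i_disj.
have span := thin_span Ia Id Imax.
have /(_ _)/cid-/all_sig[g gP] x :
    exists g : c00 I R^o, span_map (fun i : I => val i) g = x.
  have [g1 e1] := span _ (vpos_ge0 x); have [g2 e2] := span _ (vpos_ge0 (- x)).
  by exists (g1 - g2); rewrite (linB L) e1 e2 vposBneg.
by exists g => // h; apply: (span_map_inj i_gt0 i_disj); rewrite gP.
Qed.

End Atomic.

Section PrincipalThin.
Variables (R : realType) (E : archRieszType R) (x : E).
Hypothesis x0 : 0 <= x.
Implicit Types (u v w : principal x).

Lemma principal_bound v : exists2 l : R, 0 < l & vabs (val v) <= l *: x.
Proof.
have /asboolP[l [l0 vl]] := valP v; exists (l + 1); first by rewrite ltr_wpDl.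
by rewrite (vabs_id x0) in vl; rewrite (le_trans vl)// vleZl// lerDl.
Qed.

Lemma in_principal_le y (l : R) : 0 <= l -> vabs y <= l *: x -> y \in in_principal x.
Proof. by move=> l0 yl; apply/asboolP; exists l; rewrite (vabs_id x0). Qed.

Definition principal_top : principal x :=
  Principal (in_principal_le ler01
    (ltac:(by rewrite scale1r (vabs_id x0)) : vabs x <= 1 *: x)).

Lemma principal_top_bound v : exists2 l : R, 0 < l & v <= l *: principal_top.
Proof.
have [l l0 vl] := principal_bound v; exists l => //.
exact: le_trans (vabs_ge _) vl.
Qed.

Lemma principal_disj u v : disj (val u) (val v) <-> disj u v.
Proof. by split=> [d|d]; [exact: val_inj|have := congr1 val d]. Qed.

Lemma principal_gt0 u : (0 < u) = (0 < val u).
Proof.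
by apply/idP/idP => /[dup] /ltW u0 /gt_eqF/negP/negP un;
  apply: vgt0_neq0 => //; move=> h; case/negP: un; apply/eqP; [apply: val_inj|rewrite h].
Qed.

Lemma principal_thin : thin x -> forall v, 0 <= v -> thin v.
Proof.
move=> tx v v0 [u [uv ud]]; have [l l0 vl] := principal_top_bound v.
apply: (thinZ l0 tx); exists (fun n => val (u n)); split=> [n|n m nm].
  have /andP[un unv] := uv n; rewrite -principal_gt0 un.
  exact: (le_trans unv vl).
by apply/principal_disj/ud.
Qed.

Lemma principal_top_thin : thin principal_top -> thin x.
Proof.
move=> tt [u [ux ud]]; apply: tt.
have u0 n : 0 < u n by have /andP[] := ux n.
have ulx n : vabs (u n) <= 1 *: x.
  by rewrite (vabs_id (ltW (u0 n))) scale1r; have /andP[] := ux n.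
exists (fun n => Principal (in_principal_le ler01 (ulx n))); split=> [n|n m nm].
  by rewrite principal_gt0 u0 /=; have /andP[] := ux n.
by apply/principal_disj/ud.
Qed.

(** Every unit vector of c00 I lies below a multiple of the image of the strong
    unit x, whose support is finite; hence I is finite. *)
Lemma thin_finite_dimensional : thin x -> finite_dimensional (principal x).
Proof.
move=> tx; have [I [f [fh [g fK gK]]]] := thin_iso_c00 (principal_thin tx).
have [r [ur fr _]] := c00_support2 (f principal_top) (f principal_top).
have [L _ _] := fh.
have rI i : i \in r.
  apply: fr; have [l l0 zl] := principal_top_bound (g (c00_delta (G := R^o) i 1)).
  have /c00_leP/(_ i) := riesz_hom_le fh zl.
  rewrite gK (linZ L) c00_delta_eval eqxx c00Z => h.
  by apply: contraTneq h => ->; rewrite scaler0 -[_ <= _]/((1 : R) <= 0) ler10.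
exists (size r), (fun k => g (c00_delta (G := R^o) (tnth (in_tuple r) k) 1)) => v.
exists (fun k => f v (tnth (in_tuple r) k)); apply: (can_inj fK).
rewrite (lin_sum L) [LHS](c00_decomposition ur) => [|i _]; last exact: rI.
rewrite big_tnth; apply: eq_bigr => k _; rewrite (linZ L) gK.
by rewrite c00_deltaZ; congr c00_delta; rewrite [RHS]mulr1.
Qed.

(** Disjoint nonzero positive elements are linearly independent, so a sequence
    of them does not fit in n dimensions. *)
Lemma finite_dimensional_thin : finite_dimensional (principal x) -> thin x.
Proof.
move=> [n [e eP]] [u [ux ud]].
have u0 k : 0 < u k by have /andP[] := ux k.
have ulx k : vabs (u k) <= 1 *: x.
  by rewrite (vabs_id (ltW (u0 k))) scale1r; have /andP[] := ux k.
pose w k : principal x := Principal (in_principal_le ler01 (ulx k)).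
have [c cP] := all_sig (fun k => cid (eP (w k))).
pose C : 'M[R]_(n.+1, n) := \matrix_(k, i) c k i.
have : kermx C != 0.
  by rewrite -mxrank_eq0 mxrank_ker -lt0n subn_gt0 (leq_ltn_trans (rank_leq_col _)).
move=> /rowV0Pn[v /sub_kermxP vC v0].
have wsum : \sum_(k < n.+1) v 0 k *: w k = 0.
  under eq_bigr => k _ do rewrite cP scaler_sumr.
  rewrite exchange_big big1//= => i _.
  under eq_bigr => k _ do rewrite scalerA.
  have := congr1 (fun M : 'rV_n => M 0 i) vC; rewrite !mxE => h.
  rewrite -scaler_suml (_ : \sum_(k < n.+1) v 0 k * c k i = 0) ?scale0r//.
  by rewrite -[RHS]h; apply: eq_bigr => k _; rewrite mxE.
have usum : \sum_(k < n.+1) v 0 k *: u k = 0.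
  have valL : linear (val : principal x -> E) by [].
  have := congr1 val wsum; rewrite (lin_sum valL) (lin0 valL) => {2}<-.
  by apply: eq_bigr => k _.
have p0 (k : 'I_n.+1) : 0 < u k by [].
have pd (i j : 'I_n.+1) : i != j -> disj (u i) (u j) by move=> ij; apply: ud.
have [L _ _] := span_map_hom p0 pd.
have : \sum_(k < n.+1) c00_delta (G := R^o) k (v 0 k) = 0.
  apply: (span_map_inj p0 pd); rewrite (lin0 L) (lin_sum L) -[RHS]usum.
  by apply: eq_bigr => k _; rewrite (span_map_delta p0).
move=> d0; case/negP: v0; apply/eqP/rowP => k; rewrite mxE.
have := congr1 (fun g : c00 'I_n.+1 R^o => g k) d0.
rewrite (lin_sum (c00_eval_linear (G := R^o) k)) (bigD1 k)//= eqxx big1 ?addr0//.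
by move=> i ik; rewrite eq_sym (negPf ik).
Qed.

End PrincipalThin.

(** * Tensor products with finitely supported functions *)

Section SwapTensor.
Variable R : realType.
Implicit Types E F G : archRieszType R.

Lemma riesz_bimorphism_swap E F G (t : E -> F -> G) :
  riesz_bimorphism t -> riesz_bimorphism (fun y x => t x y).
Proof. by move=> [linl linr hl hr]. Qed.

Lemma is_fremlin_tensor_swap E F G (t : E -> F -> G) :
  is_fremlin_tensor t -> is_fremlin_tensor (fun y x => t x y).
Proof.
move=> [b u]; split=> [|H psi bpsi]; first exact: riesz_bimorphism_swap.
have [T [[hT tT] uT]] := u H _ (riesz_bimorphism_swap bpsi).
by exists T; split=> // T' [hT' tT']; apply: uT.
Qed.

Lemma tensor_iso E F G (t : E -> F -> G) : is_fremlin_tensor t -> E ⊗ F ≅ G.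
Proof.
move=> /(is_fremlin_tensor_unique (fremlin_tensorP E F))[f [hf bf _]].
by exists f.
Qed.

Lemma tensorC E F : E ⊗ F ≅ F ⊗ E.
Proof. exact/tensor_iso/is_fremlin_tensor_swap/fremlin_tensorP. Qed.

End SwapTensor.

Section TensorC00.
Variables (R : realType) (I : choiceType) (E F : archRieszType R).
Variables (phi : E -> c00 I R^o) (phi' : c00 I R^o -> E).
Hypotheses (phi_hom : riesz_hom phi) (phiK : cancel phi phi') (phi'K : cancel phi' phi).

Fact in_c00_scale x (y : F) : (fun i => (phi x i : R) *: y) \in @in_c00 R I F.
Proof.
apply/asboolP; apply: sub_finite_set (c00_supp_finite (phi x)) => i /=.
by apply: contra_neq => ->; rewrite scale0r.
Qed.

Definition c00_tensor x (y : F) : c00 I F := C00 (in_c00_scale x y).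

Let phiL : linear phi. Proof. by case: phi_hom. Qed.

Lemma c00_tensor_bimorphism : riesz_bimorphism c00_tensor.
Proof.
have linl y : linear (c00_tensor^~ y).
  move=> a x x'; apply/val_inj/funext => i.
  transitivity ((phi (a *: x + x') i : R) *: y) => //.
  by rewrite phiL c00D c00Z scalerDl -scalerA.
have linr x : linear (c00_tensor x).
  move=> a y y'; apply/val_inj/funext => i.
  transitivity ((phi x i : R) *: (a *: y + y')) => //.
  by rewrite scalerDr scalerA mulrC -scalerA.
split=> // [y y0|x x0]; apply: disj_riesz_hom => // u v uv.
  apply: disj_c00 => i; apply: regular_disj_scale => //.
  exact/c00_disj/riesz_hom_disj.
have /c00_leP phi0 := riesz_hom_ge0 phi_hom x0.
apply: disj_c00 => i; apply: (disjZ (phi0 i)).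
exact/disj_sym/(disjZ (phi0 i))/disj_sym.
Qed.

Lemma c00_tensor_delta i y :
  c00_tensor (phi' (c00_delta (G := R^o) i 1)) y = c00_delta i y.
Proof.
apply/val_inj/funext => j.
transitivity ((phi (phi' (c00_delta (G := R^o) i 1)) j : R) *: y) => //.
by rewrite phi'K !c00_delta_eval /=; case: eqP; rewrite ?scale1r ?scale0r.
Qed.

(** A family g with values in F is the finite sum of the tensors of the unit
    vectors with the values of g, which forces the factorization; the images
    of distinct unit vectors being disjoint, the forced formula is a Riesz
    homomorphism. *)
Lemma c00_tensorP : is_fremlin_tensor c00_tensor.
Proof.
split=> [|H psi bpsi]; first exact: c00_tensor_bimorphism.
have [psil psir hl hr] := bpsi.
have phi'L : linear phi' by move=> a g h; apply: (can_inj phiK); rewrite phiL !phi'K.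
pose eps i := phi' (c00_delta (G := R^o) i 1).
have delta0 i : 0 <= c00_delta (G := R^o) i 1.
  apply/c00_leP => j; rewrite c00_delta_eval.
  by case: eqP => _; [exact: ler01|exact: lexx].
have eps0 i : 0 <= eps i.
  have := riesz_hom_reflect_le 0 (eps i) phi_hom (can_inj phiK).
  by rewrite (lin0 phiL) phi'K delta0 => <-.
have eps_disj i j : i != j -> disj (eps i) (eps j).
  move=> ij; apply: (can_inj phiK); case: phi_hom => _ _ ->; rewrite (lin0 phiL) !phi'K.
  apply: disj_c00 => k; rewrite !c00_delta_eval; case: eqP => [->|_].
    by rewrite (negPf ij); apply/disj_sym/disj0; exact: ler01.
  by apply: disj0; case: eqP => _; [exact: ler01|exact: lexx].
have T_hom i : riesz_hom (psi (eps i)) by exact: hr.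
have T_disj i j (y z : F) : i != j -> 0 <= y -> 0 <= z ->
    disj (psi (eps i) y) (psi (eps j) z).
  move=> ij y0 z0; have yz0 := vaddr_ge0 y0 z0.
  apply: (disj_le2 _ _ _ _ (riesz_hom_disj (hl _ yz0) (eps_disj i j ij))).
  - exact: riesz_hom_ge0 y0.
  - by apply: riesz_hom_le => //; exact: vle_addr.
  - exact: riesz_hom_ge0 z0.
  - by apply: riesz_hom_le => //; exact: vle_addl.
exists (c00_sum (fun i => psi (eps i))); split.
  split=> [|x y]; first exact: c00_sum_hom.
  have [r [ur fr _]] := c00_support2 (phi x) (phi x).
  have gr i : c00_tensor x y i != 0 -> i \in r.
    by move=> ti; apply: fr; apply: contra_neq ti => /= ->; rewrite scale0r.
  rewrite (c00_sumE T_hom ur gr) -[in RHS](phiK x) (c00_decomposition ur fr).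
  rewrite (lin_sum phi'L) (lin_sum (psil y)); apply: eq_bigr => i _.
  rewrite -[LHS]/(psi (eps i) ((phi x i : R) *: y)) (linZ (psir _)) -(linZ (psil _)).
  rewrite -(linZ phi'L) c00_deltaZ; congr (psi (phi' (c00_delta _ _)) _).
  by rewrite [LHS]mulr1.
move=> T' [[T'L _ _] T't]; apply/funext => g.
have [r [ur gr _]] := c00_support2 g g.
rewrite (c00_sumE T_hom ur gr) [in RHS](c00_decomposition ur gr) (lin_sum T'L).
by apply: eq_bigr => i _; rewrite -c00_tensor_delta T't.
Qed.

End TensorC00.

Lemma tensor_c00_iso (R : realType) (I : choiceType) (E F : archRieszType R) :
  E ≅ c00 I R^o -> E ⊗ F ≅ c00 I F.
Proof.
by move=> [f [fh [g fK gK]]]; apply: tensor_iso; exact: c00_tensorP fh fK gK.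
Qed.

(** * Transfer of order completeness *)

Section Completeness.
Variables (R : realType) (A : Type).
Implicit Types E F : archRieszType R.

Lemma iso_complete E F : E ≅ F -> dedekind_complete A F -> dedekind_complete A E.
Proof.
move=> [f [fh [g fK gK]]] cplF S [x0 Sx0] [u Su] SA.
have fle x y : (f x <= f y) = (x <= y) := riesz_hom_reflect_le x y fh (can_inj fK).
have [|||s [sub smin]] := cplF (f @` S).
- by exists (f x0), x0.
- by exists (f u) => _ [x Sx <-]; rewrite fle Su.
- exact: card_le_trans (card_image_le _ _) SA.
exists (g s); split=> [x Sx|y Sy]; first by rewrite -fle gK; apply: sub; exists x.
by rewrite -fle gK; apply: smin => _ [x Sx <-]; rewrite fle Sy.
Qed.

Lemma c00_complete (I : choiceType) F :
  dedekind_complete A F -> dedekind_complete A (c00 I F).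
Proof.
move=> cplF S [f0 Sf0] [u Su] SA.
have /(_ _)/cid-/all_sig[s sP] (i : I) :
    supremums ((fun f : c00 I F => f i) @` S) !=set0.
  apply: cplF; first by exists (f0 i), f0.
    by exists (u i) => _ [f Sf <-]; have /c00_leP := Su f Sf.
  exact: card_le_trans (card_image_le _ _) SA.
(* s lies between f0 and u, hence vanishes where both do. *)
have sc : s \in @in_c00 R I F.
  apply/asboolP.
  have : finite_set (c00_supp f0 `|` c00_supp u).
    by rewrite finite_setU; split; exact: c00_supp_finite.
  apply: sub_finite_set => i /= si; apply: contrapT => /not_orP[].
  rewrite /c00_supp /= => /negP; rewrite negbK => /eqP f0i.
  move=> /negP; rewrite negbK => /eqP ui.
  case/negP: si; apply/eqP; have [sub smin] := sP i; apply: vle_anti.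
    by rewrite -ui; apply: smin => _ [f Sf <-]; have /c00_leP := Su f Sf.
  by rewrite -f0i; apply: sub; exists f0.
exists (C00 sc); split=> [f Sf|g Sg]; apply/c00_leP => i.
  by have [sub _] := sP i; apply: sub; exists f.
by have [_ smin] := sP i; apply: smin => _ [f Sf <-]; have /c00_leP := Sg f Sf.
Qed.

Lemma principal_complete E (x : E) :
  dedekind_complete A E -> dedekind_complete A (principal x).
Proof.
move=> cplE S [v0 Sv0] [u Su] SA.
have [|||s [sub smin]] := cplE (val @` S).
- by exists (val v0), v0.
- by exists (val u) => _ [v Sv <-]; exact: Su.
- exact: card_le_trans (card_image_le _ _) SA.
have v0s : val v0 <= s by apply: sub; exists v0.
have su : s <= val u by apply: smin => _ [v Sv <-]; exact: Su.
have sx : s \in in_principal x.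
  apply: (in_principal_abs _ (valP u) (valP v0)); rewrite vabs_le; apply/andP; split.
    by apply: le_trans su _; apply: le_trans (vabs_ge _) _; exact/vle_addr/vabs_ge0.
  apply: (@le_trans _ _ (- val v0)); first by rewrite vleN2.
  by apply: le_trans (vabs_geN _) _; exact/vle_addl/vabs_ge0.
exists (Principal sx); split=> [v Sv|w Sw]; first by apply: sub; exists v.
by apply: smin => _ [v Sv <-]; exact: Sw.
Qed.

End Completeness.

(** * The equivalences *)

Section Equivalences.
Variables (R : realType) (A : Type).
Hypothesis A_infinite : infinite_set [set: A].
Implicit Types E F : archRieszType R.

Lemma thin_of_tensor_complete E F (x : E) (y : F) :
  dedekind_complete A E -> dedekind_complete A F ->
  dedekind_complete A (E ⊗ F) -> thin x \/ thin y.
Proof.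
move=> cE cF cEF; apply: contrapT => /not_orP[nx ny].
have [e [e0 ed ec]] := component_sequence A_infinite cE nx.
have [f [f0 fd fc]] := component_sequence A_infinite cF ny.
exact: not_tensor_complete A_infinite e0 f0 ed fd ec fc cEF.
Qed.

(** The two universal statements separate because x and y vary
    independently. *)
Lemma finite_dimensional_or E F :
  (forall (x : E) (y : F), 0 <= x -> 0 <= y -> thin x \/ thin y) ->
  (forall x : E, 0 <= x -> finite_dimensional (principal x)) \/
  (forall y : F, 0 <= y -> finite_dimensional (principal y)).
Proof.
move=> h; apply: contrapT => /not_orP[/existsNP[x /not_implyP[x0 nx]]].
move=> /existsNP[y /not_implyP[y0 ny]].
by have [/(thin_finite_dimensional x0)|/(thin_finite_dimensional y0)] := h x y x0 y0.
Qed.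

Lemma finite_dimensional_tensor_complete E F (x : E) : 0 <= x ->
  finite_dimensional (principal x) -> dedekind_complete A F ->
  dedekind_complete A (principal x ⊗ F).
Proof.
move=> x0 /(finite_dimensional_thin x0) tx cF.
have [I xI] := thin_iso_c00 (principal_thin x0 tx).
exact: iso_complete (tensor_c00_iso _ xI) (c00_complete cF).
Qed.

Lemma finite_dimensional_c00 E :
  (forall x : E, 0 <= x -> finite_dimensional (principal x)) ->
  exists I : set E, E ≅ c00 I R^o.
Proof.
by move=> fd; apply: thin_iso_c00 => x x0; exact/finite_dimensional_thin/fd.
Qed.

End Equivalences.

Theorem theorem4p6 (R : realType) (A : Type)
    (A_infinite : infinite_set [set: A])
    (E F : archRieszType R)
    (E_complete : dedekind_complete A E) (F_complete : dedekind_complete A F) :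
  [<-> forall (x : E) (y : F), 0 <= x -> 0 <= y ->
         dedekind_complete A (principal x ⊗ principal y);
       (forall x : E, 0 <= x -> finite_dimensional (principal x)) \/
       (forall y : F, 0 <= y -> finite_dimensional (principal y));
       (exists I : set E, E ≅ c00 I R^o) \/ (exists J : set F, F ≅ c00 J R^o);
       (exists I : set E, E ⊗ F ≅ c00 I F) \/
       (exists J : set F, E ⊗ F ≅ c00 J E);
       dedekind_complete A (E ⊗ F)].
Proof.
tfae.
- move=> c1; apply: finite_dimensional_or => x y x0 y0.
  have [||/principal_top_thin|/principal_top_thin] :=
    thin_of_tensor_complete A_infinite (principal_top x0) (principal_top y0)
      _ _ (c1 x y x0 y0);
    by [exact: principal_complete|left|right].
- by case=> /finite_dimensional_c00; [left|right].
- case=> [[I EI]|[J FJ]]; first by left; exists I; exact: tensor_c00_iso.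
  by right; exists J; exact: riesz_iso_trans (tensorC E F) (tensor_c00_iso E FJ).
- by case=> [[I EI]|[J EJ]]; [apply: iso_complete EI _|apply: iso_complete EJ _];
    exact: c00_complete.
- move=> c5 x y x0 y0.
  have [fE|fF] := finite_dimensional_or
    (fun x y _ _ => thin_of_tensor_complete A_infinite x y E_complete F_complete c5).
    apply: finite_dimensional_tensor_complete => //; first exact: fE.
    exact: principal_complete.
  apply: iso_complete (tensorC _ _) _.
  apply: finite_dimensional_tensor_complete => //; first exact: fF.
  exact: principal_complete.
Qed.
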